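(* Let $H$ be a complex Hilbert space, let $A\in B(H)$ be a non-zero positive semidefinite operator, and let $T\in B_A(H)$ be an $A$-normal operator. Then $\overline{W_A(T)}\subset \operatorname{conv}(\sigma_A(T))$, where $\operatorname{conv}$ denotes the convex hull in $\mathbb C$.
   Context: $B(H)$ is the algebra of bounded linear operators on $H$; $R(\cdot)$ denotes range. $\langle x,y\rangle_A=\langle Ax,y\rangle$, $\|x\|_A=\langle Ax,x\rangle^{1/2}$. The $A$-numerical range is $W_A(T)=\{\langle Tx,x\rangle_A: x\in H,\ \|x\|_A=1\}$. $B_A(H)=\{T\in B(H): R(T^*A)\subset R(A)\}$. For $T\in B_A(H)$, $T^{\sharp}\in B(H)$ is the unique operator with $T^*A=AT^{\sharp}$ and $R(T^{\sharp})\subset\overline{R(A)}$. An operator $T\in B_A(H)$ is $A$-normal if $\|Tx\|_A=\|T^{\sharp}x\|_A$ for all $x\in H$. $B_{A^{1/2}}(H)=\{T\in B(H): R(T^*A^{1/2})\subset R(A^{1/2})\}$; equivalently, there is $d>0$ with $\|Tx\|_A\le d\|x\|_A$ for all $x\in H$. One has $B_A(H)\subset B_{A^{1/2}}(H)$. A non-zero $T\in B_{A^{1/2}}(H)$ is $A$-invertible in $B_{A^{1/2}}(H)$ if there is a non-zero $S\in B_{A^{1/2}}(H)$ with $ATS=AST=A$. For $T\in B_{A^{1/2}}(H)$, $\rho_A(T)=\{\lambda\in\mathbb C:\lambda-T\text{ is }A\text{-invertible in }B_{A^{1/2}}(H)\}$ and $\sigma_A(T)=\mathbb C\setminus\rho_A(T)$.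 *)

(* Defs.v *)
From HB Require Import structures.
From mathcomp Require Import all_boot all_order all_algebra.
From mathcomp Require Import sesquilinear complex.
From mathcomp Require Import all_classical all_reals all_analysis.

Set Implicit Arguments.
Unset Strict Implicit.
Unset Printing Implicit Defensive.

Import Order.TTheory GRing.Theory Num.Theory numFieldNormedType.Exports.
Local Open Scope classical_set_scope.
Local Open Scope ring_scope.

(* Complex Hilbert spaces: complete normed spaces over R[i] whose norm comes
   from an inner product, linear in its first argument and conjugate-linear in
   the second.  As in any normedModType over R[i], norms are (real) elements of
   R[i]; in R[i], [0 <= z] means that z is real and nonnegative. *)
HB.mixin Record isHilbert (R : realType) (H : Type)
    of CompleteNormedModule R[i] H := {
  inner : {dot H for (Num.conj : R[i] -> R[i])};
  innerE : forall x : H, inner x x = `|x| ^+ 2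
}.

#[short(type="hilbertType")]
HB.structure Definition Hilbert (R : realType) :=
  {H of isHilbert R H & CompleteNormedModule R[i] H}.

Section Operators.
Context {R : realType} {H : hilbertType R}.
Implicit Types A T S Q : H -> H.

Definition bounded_op T := linear T /\ continuous T.

(* T^*; the default value of [xget] is never used when T is in B(H) *)
Definition adjoint T : H -> H :=
  xget (cst 0) [set S : H -> H |
    bounded_op S /\ forall x y, inner (T x) y = inner x (S y)].

Definition positive_op A := bounded_op A /\ forall x, 0 <= inner (A x) x.

(* A^{1/2}; the default value of [xget] is never used when A is positive *)
Definition sqrt_op A : H -> H :=
  xget (cst 0) [set Q : H -> H | positive_op Q /\ Q \o Q = A].

Definition inner_A A (x y : H) : R[i] := inner (A x) y.

Definition norm_A A (x : H) : R[i] := sqrtC (inner_A A x x).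

Definition numerical_range_A A T : set R[i]^o :=
  [set z | exists2 x, norm_A A x = 1 & z = inner_A A (T x) x].

Definition B_A A : set (H -> H) :=
  [set T | bounded_op T /\ range (adjoint T \o A) `<=` range A].

(* T^#; the default value of [xget] is never used when T is in B_A(H) *)
Definition sharp A T : H -> H :=
  xget (cst 0) [set S : H -> H |
    [/\ bounded_op S, adjoint T \o A = A \o S
      & range S `<=` closure (range A)]].

Definition A_normal A T := forall x, norm_A A (T x) = norm_A A (sharp A T x).

Definition B_sqrtA A : set (H -> H) :=
  [set T | bounded_op T /\
    range (adjoint T \o sqrt_op A) `<=` range (sqrt_op A)].

Definition A_invertible A T :=
  [/\ B_sqrtA A T, T <> cst 0
    & exists S, [/\ B_sqrtA A S, S <> cst 0,
                    A \o T \o S = A & A \o S \o T = A]].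

Definition resolvent_A A T : set R[i]^o :=
  [set l | A_invertible A (fun x => (l : R[i]) *: x - T x)].

Definition spectrum_A A T : set R[i]^o := ~` resolvent_A A T.

End Operators.

(* The coefficients [k : {i01 R[i]}] in [convex_set] satisfy 0 <= k <= 1 in
   R[i], hence are real: this is convexity in the real plane underlying R[i]. *)
Definition convex_hull {R : realType} (D : set R[i]^o) : set R[i]^o :=
  smallest (@convex_set R[i] R[i]^o) D.

(* Main.v *)
(* Everything happens for the real semi-inner product g(x, y) = Re <Ax, y>, in
   which the A-adjoint U of T satisfies g(Tx, y) = g(x, Uy) and
   g(Tx, Tx) = g(Ux, Ux), so T is normal up to null vectors. If z lies in the
   closure of W_A(T) but not in C = conv (sigma_A(T)), some a != 0 satisfies
   Re a(w - z) <= 0 for all w in C. Put N = a(T - z), with real and imaginary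
   parts X and Y, and let M >= 0 be the supremum of the A-numerical range of X.
   There are vectors on which M - X is arbitrarily small; iterating a shift of Y
   on them, which commutes with X up to null vectors, yields approximate
   eigenvectors common to X and Y, hence an approximate eigenvalue M + i mu of N. A boundedly
   A-invertible operator is bounded below, so z + (M + i mu)/a is in C and M = 0.
   In that case the vectors can be chosen with Y almost annihilated in mean, and
   since the Rayleigh quotients of the iteration increase, mu >= 0; iterating a
   shift of -Y instead gives some mu' <= 0, and z is on the segment joining the
   two points of C so obtained. *)
Require Import Defs.
From HB Require Import structures.
From mathcomp Require Import all_boot all_order all_algebra.
From mathcomp Require Import sesquilinear complex.
From mathcomp Require Import all_classical all_reals all_analysis.
From mathcomp Require Import ring lra.
Import Order.TTheory GRing.Theory Num.Theory numFieldNormedType.Exports.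
Local Open Scope classical_set_scope.
Local Open Scope ring_scope.

Set Implicit Arguments.
Unset Strict Implicit.
Unset Printing Implicit Defensive.

(** * The plane *)

Section Plane.
Context {R : realType}.
Implicit Types C D : set R[i]^o.

Lemma convex_setP C : @convex_set R[i] R[i]^o C ->
  forall (x y : R[i]) (t : R), C x -> C y -> 0 <= t <= 1 ->
  C (t%:C%C * x + (1 - t)%:C%C * y).
Proof.
move=> cC x y t Cx Cy /andP[t0 t1].
have t0' : 0 <= t%:C%C :> R[i] by rewrite ler0c.
have t1' : t%:C%C <= 1 :> R[i] by rewrite -[1]/((1 : R)%:C%C) lecR.
have := cC x y (Itv01 t0' t1'); rewrite !inE => /(_ Cx Cy).
by rewrite rmorphB.
Qed.

Lemma convex_convex_hull D : @convex_set R[i] R[i]^o (convex_hull D).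
Proof.
move=> x y k; rewrite !inE => hx hy B [cB DB].
by have := cB x y k; rewrite !inE; apply; [apply: hx|apply: hy].
Qed.

Definition convex2 (P : R -> R -> Prop) := forall x y x' y' t : R,
  P x y -> P x' y' -> 0 <= t <= 1 ->
  P (t * x + (1 - t) * x') (t * y + (1 - t) * y').

(** The point exhibited is where the segment from [(u, v)] to [(x, y)] crosses the horizontal
    axis. *)
Lemma convex2_axis (P : R -> R -> Prop) (u v x y : R) : convex2 P ->
  P u v -> P x y -> 0 < v -> y < 0 -> P ((x * v - u * y) / (v - y)) 0.
Proof.
move=> cP Puv Pxy v0 y0; have d0 : v - y != 0 by lra.
have t01 : 0 <= - y / (v - y) <= 1.
  by rewrite divr_ge0 ?ler_pdivrMr//=; lra.
have := cP _ _ _ _ _ Puv Pxy t01.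
by congr (P _ _); field.
Qed.

(** Segments between the two half-planes cross the axis at positive abscissae, so each quotient
    [x / y] from below is at most each one from above; the supremum of the former is a suitable
    slope. *)
Lemma separation_axis (P : R -> R -> Prop) : convex2 P ->
  (exists x y, P x y /\ 0 < y) -> (exists x y, P x y /\ y < 0) ->
  (forall x, P x 0 -> 0 < x) ->
  exists s, forall x y, P x y -> s * y <= x.
Proof.
move=> cP [u0 [v0 [P0 v0_gt0]]] [x0 [y0 [P0' y0_lt0]]] axis.
have cross u v x y : P u v -> P x y -> 0 < v -> y < 0 -> x / y <= u / v.
  move=> Puv Pxy vp yn; have := axis _ (convex2_axis cP Puv Pxy vp yn).
  rewrite pmulr_lgt0 ?invr_gt0; last lra.
  move=> xv; rewrite ler_pdivlMr// mulrAC ler_ndivrMr//; lra.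
pose L := [set z | exists x y, [/\ P x y, y < 0 & z = x / y]].
have supL : has_sup L.
  split; first by exists (x0 / y0), x0, y0.
  by exists (u0 / v0) => _ [x [y [Pxy yn ->]]]; apply: cross.
exists (sup L) => x y Pxy; have [yn|yp|y_eq0] := ltrgtP y 0.
- by rewrite -ler_ndivrMr//; apply: ub_le_sup; [case: supL|exists x, y].
- rewrite -ler_pdivlMr//; apply: ge_sup; first by case: supL.
  by move=> _ [x' [y' [P' yn ->]]]; apply: cross.
- by rewrite y_eq0 mulr0 ltW// axis// -y_eq0.
Qed.

(** If [P] misses an open upper or lower half-plane, the horizontal axis separates. Otherwise
    convexity keeps the axis points of [P] on one side of the origin, and [separation_axis] applies,
    after a reflection when that side is the left one. *)
Lemma separation2 (P : R -> R -> Prop) : convex2 P -> ~ P 0 0 ->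
  exists a b : R, (a, b) != (0, 0) /\ forall x y, P x y -> a * x - b * y <= 0.
Proof.
move=> cP P0.
have [U|nU] := pselect (exists x y, P x y /\ 0 < y); last first.
  exists 0, (-1); split => [|x y Pxy]; first by rewrite xpair_eqE oppr_eq0 oner_eq0 andbF.
  rewrite mul0r; have [|] := lerP y 0; first lra.
  by move=> y0; case: nU; exists x, y.
have [L|nL] := pselect (exists x y, P x y /\ y < 0); last first.
  exists 0, 1; split => [|x y Pxy]; first by rewrite xpair_eqE oner_eq0 andbF.
  rewrite mul0r; have [|] := lerP 0 y; first lra.
  by move=> y0; case: nL; exists x, y.
have axis x x' : P x 0 -> P x' 0 -> 0 < x -> 0 < x'.
  move=> Px Px' x0; have [//|x'0] := ltrP 0 x'; case: P0.
  have d0 : x - x' != 0 by lra.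
  have t01 : 0 <= - x' / (x - x') <= 1.
    by rewrite divr_ge0 ?ler_pdivrMr//=; lra.
  by have := cP _ _ _ _ _ Px Px' t01; congr (P _ _); field.
have [[x [Px x0]]|nx] := pselect (exists x, P x 0 /\ 0 < x).
  have [s sP] := separation_axis cP U L (fun x' Px' => axis x x' Px Px' x0).
  exists (-1), (- s); split => [|x' y /sP]; last lra.
  by rewrite xpair_eqE oppr_eq0 oner_eq0.
have [|||x Px|s sP] := @separation_axis (fun x y => P (- x) y).
- by move=> x y x' y' t Px Px' t01; have := cP _ _ _ _ _ Px Px' t01; congr (P _ _); ring.
- by have [x [y ?]] := U; exists (- x), y; rewrite opprK.
- by have [x [y ?]] := L; exists (- x), y; rewrite opprK.
- rewrite -oppr_lt0 lt_neqAle; apply/andP; split.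
    by apply/eqP => xe; apply: P0; rewrite xe in Px.
  by rewrite leNgt; apply/negP => x0; apply: nx; exists (- x).
exists 1, (- s); split => [|x y Pxy]; first by rewrite xpair_eqE oner_eq0.
have := sP (- x) y; rewrite opprK => /(_ Pxy); lra.
Qed.

(** [a * x - b * y] is the real part of [(a + ib)(x + iy)], so a planar functional is multiplication
    by a complex number. *)
Lemma weak_separation C (z : R[i]) : @convex_set R[i] R[i]^o C -> ~ C z ->
  exists2 a : R[i], a != 0 & forall w, C w -> complex.Re (a * (w - z)) <= 0.
Proof.
move=> cC Cz.
have [||a [b [ab0 abP]]] := @separation2 (fun x y => C (z + (x +i* y)%C)).
- move=> x y x' y' t Cx Cy t01.
  have := convex_setP cC Cx Cy t01; congr (C _).
  rewrite !mulrDr addrACA -mulrDl -rmorphD/= (_ : t + (1 - t) = 1) ?mul1r; last ring.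
  by congr (_ + _); simpc.
- by rewrite addr0.
exists (a +i* b)%C => [|w Cw].
  by apply: contra ab0; rewrite eq_complex/= xpair_eqE.
have := abP (complex.Re (w - z)) (complex.Im (w - z)).
have -> : (complex.Re (w - z) +i* complex.Im (w - z))%C = w - z by case: (w - z).
by rewrite addrC subrK => /(_ Cw); case: (w - z).
Qed.

End Plane.

(** * Semi-inner products *)

Lemma quadratic_discr_le (R : realFieldType) (a b c : R) : 0 <= a ->
  (forall t, 0 <= c + 2 * t * b + t ^+ 2 * a) -> b ^+ 2 <= c * a.
Proof.
move=> a_ge0 P; have [a0|a0] := eqVneq a 0.
  have [->|b0] := eqVneq b 0; first by rewrite expr0n/= a0 mulr0.
  have := P (- (c + 1) / (2 * b)).
  rewrite a0 mulr0 addr0 (_ : 2 * _ * _ = - (c + 1)); last by field.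
  lra.
have a_gt0 : 0 < a by rewrite lt_neqAle eq_sym a0.
have := P (- b / a).
rewrite (_ : _ + _ + _ = (c * a - b ^+ 2) / a); last by field.
by rewrite pmulr_lge0 ?invr_gt0// subr_ge0.
Qed.

(** The model is the real part of a complex semi-inner product. Real values keep the estimates in
    [R], and [si_im] retains the complex structure; nonzero null vectors are allowed. *)
Record semi_inner (R : realType) (V : lmodType R[i]) (g : V -> V -> R) : Prop :=
  SemiInner {
    siDl : forall x y z, g (x + y) z = g x z + g y z;
    siZl : forall (t : R) x y, g (t%:C%C *: x) y = t * g x y;
    siC : forall x y, g x y = g y x;
    si_ge0 : forall x, 0 <= g x x;
    si_im : forall x y, g ('i%C *: x) y = - g x ('i%C *: y) }.

Section SemiInnerTheory.
Context {R : realType} {V : lmodType R[i]} (g : V -> V -> R).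
Hypothesis hg : semi_inner g.
Implicit Types x y z : V.

Lemma siDr x y z : g x (y + z) = g x y + g x z.
Proof. by rewrite siC// siDl// !(siC hg x). Qed.

Lemma siZr (t : R) x y : g x (t%:C%C *: y) = t * g x y.
Proof. by rewrite siC// siZl// (siC hg x). Qed.

Lemma siNl x y : g (- x) y = - g x y.
Proof. by have := siZl hg (-1) x y; rewrite rmorphN1 scaleN1r mulN1r. Qed.

Lemma siNr x y : g x (- y) = - g x y.
Proof. by rewrite siC// siNl (siC hg). Qed.

Lemma siBl x y z : g (x - y) z = g x z - g y z.
Proof. by rewrite siDl// siNl. Qed.

Lemma siBr x y z : g x (y - z) = g x y - g x z.
Proof. by rewrite siDr siNr. Qed.

Lemma si0l y : g 0 y = 0.
Proof. by rewrite -(subrr y) siBl subrr. Qed.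

Lemma sqD x y : g (x + y) (x + y) = g x x + 2 * g x y + g y y.
Proof. by rewrite siDl// !siDr (siC hg y x); ring. Qed.

Lemma sqB x y : g (x - y) (x - y) = g x x - 2 * g x y + g y y.
Proof. by rewrite siBl// !siBr (siC hg y x); ring. Qed.

Lemma sqZ (t : R) x : g (t%:C%C *: x) (t%:C%C *: x) = t ^+ 2 * g x x.
Proof. by rewrite siZl// siZr; ring. Qed.

Lemma sq_im x : g ('i%C *: x) ('i%C *: x) = g x x.
Proof. by rewrite si_im// scalerA -expr2 sqr_i scaleN1r siNr opprK. Qed.

Lemma si_im_diag x : g x ('i%C *: x) = 0.
Proof. by have := si_im hg x x; rewrite (siC hg _ x); lra. Qed.

Lemma scale_ReIm (c : R[i]) x :
  c *: x = (complex.Re c)%:C%C *: x + (complex.Im c)%:C%C *: ('i%C *: x).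
Proof. by rewrite [in LHS](complexE c) scalerDl scalerA [_ * 'i%C]mulrC. Qed.

Lemma si_conj (c : R[i]) x y : g (c *: x) y = g x (c^*%C *: y).
Proof.
rewrite (scale_ReIm c) (scale_ReIm c^*%C) siDl// siDr !siZl// !siZr.
by rewrite si_im//; case: c => a b /=; ring.
Qed.

Lemma sqZc (c : R[i]) x :
  g (c *: x) (c *: x) = (complex.Re c ^+ 2 + complex.Im c ^+ 2) * g x x.
Proof.
by rewrite (scale_ReIm c) sqD !sqZ sq_im siZl// siZr si_im_diag; ring.
Qed.

Lemma si_CauchySchwarz x y : g x y ^+ 2 <= g x x * g y y.
Proof.
apply: quadratic_discr_le (si_ge0 hg y) _ => t.
by have := si_ge0 hg (x + t%:C%C *: y); rewrite sqD sqZ siZr mulrA.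
Qed.

Lemma si_null x y : g x x = 0 -> g x y = 0.
Proof.
move=> x0; have := si_CauchySchwarz x y; rewrite x0 mul0r => h.
by apply/eqP; rewrite -sqrf_eq0 eq_le h sqr_ge0.
Qed.

Lemma si_null_eq x y z : g (x - y) (x - y) = 0 -> g x z = g y z.
Proof. by move=> /(@si_null _ z); rewrite siBl => /eqP; rewrite subr_eq0 => /eqP. Qed.

Lemma sq_null_eq x y : g (x - y) (x - y) = 0 -> g x x = g y y.
Proof.
by move=> h; rewrite (si_null_eq _ h) (siC hg) (si_null_eq _ h).
Qed.

Lemma sqD_le x y : g (x + y) (x + y) <= 2 * (g x x + g y y).
Proof. by have := si_ge0 hg (x - y); rewrite sqB sqD; lra. Qed.

End SemiInnerTheory.

(** * Power iteration for a symmetric operator *)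

Section ApproximateEigenvectors.
Context {R : realType} {V : lmodType R[i]} (g : V -> V -> R).
Hypothesis hg : semi_inner g.

Definition si_symmetric (f : V -> V) := forall x y, g (f x) y = g x (f y).

Lemma semi_inner_op (Z : {linear V -> V}) : si_symmetric Z ->
  (forall x, 0 <= g (Z x) x) -> semi_inner (fun x y => g (Z x) y).
Proof.
move=> symZ Z0; split => //.
- by move=> x y z; rewrite linearD siDl.
- by move=> t x y; rewrite linearZ siZl.
- by move=> x y; rewrite symZ (siC hg).
- by move=> x y; rewrite linearZ si_im.
Qed.

(* Power iteration: the Rayleigh quotients [g (Z v) v / g v v] of the iterates
   increase and stay below [L], so one of the first [L / d] increments is at
   most [d]; the residual is controlled by the increment. *)
Lemma power_iteration (Z : {linear V -> V}) (L d : R) (K : nat) (x : V) :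
  si_symmetric Z -> (forall x, g x x <= g (Z x) x) ->
  (forall x, g (Z x) x <= L * g x x) -> 0 < d -> L <= d * K%:R ->
  0 < g x x ->
  exists k t, let v := iter k Z x in
    [/\ (k < K)%N, g (Z x) x <= t * g x x, t <= L, 0 < g v v &
        g (Z v - t%:C%C *: v) (Z v - t%:C%C *: v) <= L * d * g v v].
Proof.
move=> symZ Zge Zle d0 LK x0.
pose v k := iter k Z x.
have Z0 y : 0 <= g (Z y) y by apply: le_trans (Zge y); exact: si_ge0.
have hZ := semi_inner_op symZ Z0.
pose a k := g (v k) (v k); pose b k := g (Z (v k)) (v k).
have bE k : g (Z (v k)) (v k.+1) = a k.+1 by [].
have ab k : a k <= b k by exact: Zge.
have bL k : b k <= L * a k by exact: Zle.
have CS1 k : b k ^+ 2 <= a k.+1 * a k by exact: si_CauchySchwarz.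
have CS2 k : a k.+1 ^+ 2 <= b k * b k.+1.
  by have := si_CauchySchwarz hZ (v k) (v k.+1).
have a_gt0 k : 0 < a k.
  elim: k => [//|k IH]; have bk : 0 < b k by exact: lt_le_trans (ab k).
  have : 0 < a k.+1 * a k by apply: lt_le_trans (CS1 k); rewrite exprn_gt0.
  by rewrite pmulr_lgt0.
have b_gt0 k : 0 < b k by exact: lt_le_trans (ab k).
pose t k := b k / a k.
have t_gt0 k : 0 < t k by rewrite divr_gt0.
(* The ratios [a k.+1 / b k] interlace the Rayleigh quotients: [t k <= a k.+1 / b k <= t k.+1]. *)
have ts k : t k <= a k.+1 / b k.
  by rewrite ler_pdivrMr// mulrAC ler_pdivlMr// -expr2.
have st k : a k.+1 / b k <= t k.+1.
  by rewrite ler_pdivrMr// mulrC mulrA ler_pdivlMr// -expr2.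
have t_mono k : t 0%N <= t k.
  by elim: k => [//|k IH]; apply: (le_trans IH); apply: le_trans (ts k) (st k).
have tL k : t k <= L by rewrite ler_pdivrMr.
have [k kK tk] : exists2 k, (k < K)%N & t k.+1 - t k <= d.
  apply: contrapT => nk.
  have tgrow k : (k <= K)%N -> d * k%:R < t k.
    elim: k => [_|k IH kK]; first by rewrite mulr0.
    have := IH (ltnW kK); have [|dk] := lerP (t k.+1 - t k) d.
      by move=> tk; case: nk; exists k.
    by rewrite -natr1 mulrDr mulr1; lra.
  by have := tgrow K (leqnn _); have := tL K; lra.
exists k, (t k); split => //.
- by rewrite -ler_pdivrMr//; exact: t_mono.
- exact: a_gt0.
rewrite sqB// siZr// sqZ// -/(v k) -/(a k) -/(b k).
rewrite -[g (Z (v k)) (Z (v k))]/(a k.+1).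
(* The squared residual is exactly [b k] times the gap between [t k] and the interlaced ratio, and
   the increment bounds this gap. *)
have -> : a k.+1 - 2 * (t k * b k) + t k ^+ 2 * a k = b k * (a k.+1 / b k - t k).
  by rewrite /t; field; rewrite !gt_eqF.
have inc : a k.+1 / b k - t k <= d by have := st k; lra.
apply: (@le_trans _ _ (b k * d)); first by rewrite ler_pM2l.
by rewrite mulrAC ler_pM2r.
Qed.

End ApproximateEigenvectors.

(** * Joint approximate eigenvectors of two commuting operators *)

Section JointApproximateEigenvectors.
Context {R : realType} {V : lmodType R[i]} (g : V -> V -> R).
Hypothesis hg : semi_inner g.
Local Notation si_symmetric := (si_symmetric g).

(** Cauchy-Schwarz for the form [g (P x) y], applied to [x] and [P x], leaves one factor
    [g (P x) (P x)] to cancel. *)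
Lemma positive_op_sq_le (P : {linear V -> V}) (B : R) : 0 <= B ->
  si_symmetric P -> (forall x, 0 <= g (P x) x) ->
  (forall x, g (P x) x <= B * g x x) ->
  forall x, g (P x) (P x) <= B * g (P x) x.
Proof.
move=> B0 symP P0 PB x; have hP := semi_inner_op hg symP P0.
have := si_CauchySchwarz hP x (P x); have := PB (P x).
have := si_ge0 hg (P x); rewrite le_eqVlt => /predU1P[<- _ _|q0 PP CS].
  by rewrite mulr_ge0.
rewrite -(ler_pM2r q0) -expr2 (le_trans CS)// mulrAC mulrC.
by rewrite ler_wpM2r.
Qed.

(** Commutation holds only up to null vectors, since an adjoint for [g] is itself determined only
    modulo these. *)
Definition si_commute (f h : V -> V) := forall x, let d := f (h x) - h (f x) in g d d = 0.

Lemma iter_lower (Z : {linear V -> V}) : (forall x, g x x <= g (Z x) x) ->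
  forall k x, g x x <= g (iter k Z x) (iter k Z x).
Proof.
move=> Zge; elim=> [//|k IH] x; apply: (le_trans (IH x)); rewrite iterS.
set v := iter k Z x; have [v0|v0] := lerP (g v v) 0.
  by rewrite (le_trans v0)// si_ge0.
rewrite -(ler_pM2r v0) (le_trans _ (si_CauchySchwarz hg (Z v) v))// expr2.
by apply: ler_pM => //; exact: ltW.
Qed.

Lemma commute_iter_le (P Z : {linear V -> V}) (L : R) : si_commute P Z ->
  (forall x, g (Z x) (Z x) <= L * g x x) -> 0 <= L ->
  forall k x, g (P (iter k Z x)) (P (iter k Z x)) <= L ^+ k * g (P x) (P x).
Proof.
move=> PZ Zle L0; elim=> [|k IH] x; first by rewrite mul1r.
rewrite iterS (sq_null_eq hg (PZ _)) (le_trans (Zle _))// exprS -mulrA.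
by rewrite ler_wpM2l.
Qed.

(** Power iteration starts from a vector nearly annihilated by [P]. Commutation keeps [P] small on
    the iterates, which do not shrink. The number [K] of steps depends only on [L] and [e], so the
    starting precision [h] can be chosen after it. *)
Lemma joint_approx_eigenvector (P Z : {linear V -> V}) (L B lo e : R) :
  1 <= L -> 0 < B ->
  si_symmetric Z -> (forall x, g x x <= g (Z x) x) ->
  (forall x, g (Z x) x <= L * g x x) ->
  si_symmetric P -> (forall x, 0 <= g (P x) x) ->
  (forall x, g (P x) x <= B * g x x) -> si_commute P Z ->
  (forall h : R, 0 < h -> exists x, [/\ 0 < g x x, g (P x) x <= h * g x x &
    (lo - h) * g x x <= g (Z x) x]) -> 0 < e ->
  exists v t, [/\ 0 < g v v, lo - e <= t <= L,
    g (Z v - t%:C%C *: v) (Z v - t%:C%C *: v) <= e * g v v &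
    g (P v) (P v) <= e * g v v].
Proof.
move=> L1 B0 symZ Zge Zle symP P0 PB PZ approx e0.
have L0 : 0 < L by lra.
have Z0 x : 0 <= g (Z x) x by apply: le_trans (Zge x); exact: si_ge0.
have ZL x : g (Z x) (Z x) <= L ^+ 2 * g x x.
  rewrite (le_trans (positive_op_sq_le (ltW L0) symZ Z0 Zle x))//.
  by rewrite expr2 -mulrA ler_pM2l.
pose K := (Num.truncn (L / (e / L))).+1.
have LK : L <= e / L * K%:R.
  by rewrite -ler_pdivrMl ?divr_gt0// mulrC ltW// truncnS_gt.
(* The first bound limits the loss on [lo]; the second absorbs the amplification by at most
   [(L ^+ 2) ^+ K] and the factor [B] from [positive_op_sq_le]. *)
pose h := Num.min e (e / (B * (L ^+ 2) ^+ K)).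
have Lk_gt0 k : 0 < (L ^+ 2) ^+ k by rewrite !exprn_gt0.
have h0 : 0 < h by rewrite lt_min e0 divr_gt0// mulr_gt0.
have [x [x0 Px Zx]] := approx h h0.
have [k [t [kK tlo tL v0 res]]] :=
  power_iteration hg symZ Zge Zle (divr_gt0 e0 L0) LK x0.
exists (iter k Z x), t; split => //.
- rewrite tL andbT; have : (lo - h) * g x x <= t * g x x by exact: le_trans tlo.
  have : h <= e by rewrite ge_min lexx.
  by rewrite ler_pM2r//; lra.
- by rewrite (le_trans res)// mulrCA divff ?mulr1// gt_eqF.
rewrite (le_trans (commute_iter_le PZ ZL (sqr_ge0 L) k x))//.
apply: (@le_trans _ _ ((L ^+ 2) ^+ K * (B * (h * g x x)))).
  apply: ler_pM; [exact: ltW|exact: si_ge0| |].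
    by rewrite ler_weXn2l ?(ltnW kK)// exprn_ege1.
  rewrite (le_trans (positive_op_sq_le (ltW B0) symP P0 PB x))//.
  by rewrite ler_pM2l.
rewrite !mulrA; apply: ler_pM; rewrite ?(ltW x0)//; last exact: iter_lower.
  by rewrite !mulr_ge0// ltW.
rewrite -ler_pdivlMl ?mulr_gt0// [_^-1 * _]mulrC [_ * B]mulrC.
by rewrite ge_min lexx orbT.
Qed.

(** The approximate eigenvalues for the precisions [1 / (n + 1)] lie in the compact segment from
    [lo - 1] to [L]; a cluster point serves all precisions at once. *)
Lemma joint_approx_eigenvalue (P Z : {linear V -> V}) (L B lo : R) :
  1 <= L -> 0 < B ->
  si_symmetric Z -> (forall x, g x x <= g (Z x) x) ->
  (forall x, g (Z x) x <= L * g x x) ->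
  si_symmetric P -> (forall x, 0 <= g (P x) x) ->
  (forall x, g (P x) x <= B * g x x) -> si_commute P Z ->
  (forall h : R, 0 < h -> exists x, [/\ 0 < g x x, g (P x) x <= h * g x x &
    (lo - h) * g x x <= g (Z x) x]) ->
  exists2 t, lo <= t & forall e : R, 0 < e -> exists v, [/\ 0 < g v v,
    g (Z v - t%:C%C *: v) (Z v - t%:C%C *: v) <= e * g v v &
    g (P v) (P v) <= e * g v v].
Proof.
move=> L1 B0 symZ Zge Zle symP P0 PB PZ approx.
have /choice[vt vtP] : forall n : nat, exists vt : V * R,
  let e : R := n.+1%:R^-1 in let v := vt.1 in let t : R := vt.2 in
  [/\ 0 < g v v, lo - e <= t <= L,
    g (Z v - t%:C%C *: v) (Z v - t%:C%C *: v) <= e * g v v &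
    g (P v) (P v) <= e * g v v].
  move=> n; have e0 : 0 < n.+1%:R^-1 :> R by rewrite invr_gt0.
  have [v [t vt]] := joint_approx_eigenvector L1 B0 symZ Zge Zle symP P0 PB PZ
    approx e0.
  by exists (v, t).
have inI : (((fun n => (vt n).2) @ \oo) `[lo - 1, L])%classic.
  exists 0%N => // n _ /=; have [_ /andP[h1 h2] _ _] := vtP n.
  rewrite in_itv/= h2 andbT (le_trans _ h1)// lerD2l lerN2.
  by rewrite invf_le1// ler1n.
have [t [_ clt]] : exists t : R, `[lo - 1, L]%classic t /\
    cluster ((fun n => (vt n).2) @ \oo) t := segment_compact _ inI.
have near_t (e : R) : 0 < e -> exists n, [/\ `|(vt n).2 - t| < e & n.+1%:R^-1 < e :> R].
  move=> e0; have ballt : nbhs t (ball t e) by exact: nbhsx_ballx.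
  have tail : ((fun n => (vt n).2) @ \oo) [set s | exists n, s = (vt n).2 /\ n.+1%:R^-1 < e].
    have := near_infty_natSinv_lt (PosNum e0); apply: filterS => n /= hn.
    by exists n.
  have [s [[n [-> hn]] hb]] := clt _ _ tail ballt.
  by exists n; split => //; rewrite distrC.
exists t.
  rewrite leNgt; apply/negP => lo_t; have e0 : 0 < (lo - t) / 2 by lra.
  have [n [hn1 hn]] := near_t _ e0; have [_ /andP[h1 _] _ _] := vtP n.
  have absurd (s d : R) : lo - d <= s -> `|s - t| < (lo - t) / 2 ->
      d < (lo - t) / 2 -> False.
    by rewrite ltr_norml => ? /andP[? ?] ?; lra.
  exact: absurd h1 hn1 hn.
(* [sqD_le] doubles two errors, the residual and [(s - t) ^+ 2], each at most [d]; [d <= 1] ensures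
   [d ^+ 2 <= d]. *)
move=> e e0; pose d : R := Num.min 1 (e / 4).
have d0 : 0 < d by rewrite lt_min ltr01 divr_gt0.
have d1 : d <= 1 by rewrite ge_min lexx.
have de : d <= e / 4 by rewrite ge_min lexx orbT.
have [n [tn hn]] := near_t _ d0; have [] := vtP n.
set v := (vt n).1; set s := (vt n).2 => v0 _ Zv Pv.
have le_d c : g c c <= n.+1%:R^-1 * g v v -> g c c <= d * g v v.
  by move=> h; rewrite (le_trans h)// ler_pM2r// ltW.
exists v; split => //; last first.
  by rewrite (le_trans (le_d _ Pv))// ler_pM2r//; lra.
have -> : Z v - t%:C%C *: v = (Z v - s%:C%C *: v) + (s - t)%:C%C *: v.
  by rewrite rmorphB scalerBl addrA subrK.
rewrite (le_trans (sqD_le hg _ _))// sqZ//.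
have st : (s - t) ^+ 2 <= d.
  have h : `|s - t| ^+ 2 <= d * d by rewrite expr2; apply: ler_pM; rewrite ?normr_ge0// ltW.
  by move: h; rewrite real_normK ?num_real// => h; rewrite (le_trans h)// -[leRHS]mulr1 ler_pM2l.
have := le_d _ Zv; have : (s - t) ^+ 2 * g v v <= d * g v v by rewrite ler_pM2r.
have : d * g v v <= e / 4 * g v v by rewrite ler_pM2r.
lra.
Qed.

End JointApproximateEigenvectors.

(** * Normal operators for a semi-inner product *)

Lemma bernoulli (R : realType) (s : R) n : 1 <= s -> 1 + n%:R * (s - 1) <= s ^+ n.
Proof.
move=> s1; elim: n => [|n IH]; first by rewrite mul0r addr0.
rewrite exprS -natr1; apply: le_trans (ler_wpM2l (le_trans ler01 s1) IH).
have : 0 <= n%:R * (s - 1) ^+ 2 by rewrite mulr_ge0// sqr_ge0.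
nra.
Qed.

Section Normal.
Context {R : realType} {V : lmodType R[i]} (g : V -> V -> R).
Hypothesis hg : semi_inner g.
Local Notation si_symmetric := (si_symmetric g).
Local Notation si_commute := (si_commute g).

(** By log-convexity the ratios of successive squared norms along an orbit do not decrease. A first
    ratio above [c] would make the orbit outgrow [K * c ^+ n], even for a [K] depending on the
    orbit. *)
Lemma log_convex_bound (T : V -> V) (c : R) : 0 < c ->
  (forall x, g (T x) (T x) ^+ 2 <= g x x * g (T (T x)) (T (T x))) ->
  (forall x, exists K, forall n, g (iter n T x) (iter n T x) <= K * c ^+ n) ->
  forall x, g (T x) (T x) <= c * g x x.
Proof.
move=> c0 logT growth x; rewrite leNgt; apply/negP => cx.
have := si_ge0 hg x; rewrite le_eqVlt => /predU1P[x0|x0].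
  have := logT x; rewrite -x0 mul0r; move: cx; rewrite -x0 mulr0 => cx.
  by rewrite leNgt exprn_gt0.
pose q n := g (iter n T x) (iter n T x); pose r := q 1%N / q 0%N.
have rc : c < r by rewrite ltr_pdivlMr.
have q_gt0 n : 0 < q n /\ r * q n <= q n.+1.
  elim: n => [|n [IH1 IH2]]; first by split => //; rewrite divfK// gt_eqF.
  have qn1 : 0 < q n.+1 by apply: lt_le_trans IH2; rewrite mulr_gt0//; lra.
  split => //; rewrite -(ler_pM2r IH1) [leRHS]mulrC.
  by apply: le_trans (logT (iter n T x)); rewrite mulrAC expr2 ler_pM2r.
have rn n : r ^+ n * q 0%N <= q n.
  elim: n => [|n IH]; first by rewrite mul1r.
  rewrite exprS -mulrA (le_trans _ (q_gt0 n).2)// ler_pM2l//; lra.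
have [K KP] := growth x; pose s := r / c.
have s1 : 1 < s by rewrite ltr_pdivlMr// mul1r.
have sK n : n%:R * (s - 1) <= K / q 0%N.
  have := bernoulli n (ltW s1); have : s ^+ n <= K / q 0%N.
    rewrite expr_div_n ler_pdivlMr// mulrAC ler_pdivrMr ?exprn_gt0//.
    exact: le_trans (rn n) (KP n).
  lra.
have := sK (Num.truncn (K / q 0%N / (s - 1))).+1; apply/negP; rewrite -ltNge.
by rewrite -ltr_pdivrMr ?subr_gt0// truncnS_gt.
Qed.

Lemma null_lin (a b : R[i]) (x y : V) : g x x = 0 -> g y y = 0 ->
  g (a *: x + b *: y) (a *: x + b *: y) = 0.
Proof.
move=> x0 y0; rewrite sqD// !sqZc// x0 y0 si_conj// si_null// !mulr0.
by rewrite !addr0.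
Qed.

Lemma si_commuteC (f h : V -> V) : si_commute f h -> si_commute h f.
Proof.
move=> fh x /=; rewrite -opprB siNl// siNr// opprK; exact: fh.
Qed.

Lemma si_commute_lin (f h k : {linear V -> V}) (a b : R[i]) :
  si_commute f h -> si_commute f k -> si_commute f (a \*: h \+ b \*: k).
Proof.
move=> fh fk x /=; rewrite linearD !linearZ /= opprD addrACA -!scalerBr.
exact: null_lin (fh x) (fk x).
Qed.

Lemma si_commute_id (f : V -> V) : si_commute f idfun.
Proof. by move=> x /=; rewrite subrr si0l. Qed.

Lemma si_commute_refl (f : V -> V) : si_commute f f.
Proof. by move=> x /=; rewrite subrr si0l. Qed.

(** Normality kills the quadratic form of the commutator [D], which is symmetric; expanding this
    form at [x + D x] leaves [2 * g (D x) (D x) = 0]. *)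
Lemma normal_commute (N N' : {linear V -> V}) :
  (forall x y, g (N x) y = g x (N' y)) ->
  (forall x, g (N x) (N x) = g (N' x) (N' x)) -> si_commute N N'.
Proof.
move=> adj nrm.
have adj' x y : g (N' x) y = g x (N y) by rewrite (siC hg) -adj (siC hg).
pose D x := N (N' x) - N' (N x).
have D0 x : g (D x) x = 0.
  by rewrite /D siBl// (adj (N' x)) (adj' (N x)) nrm subrr.
have symD x y : g (D x) y = g x (D y).
  by rewrite /D siBl// siBr// (adj (N' x)) (adj' (N x)) (adj' x) (adj x).
have DD x y : D (x + y) = D x + D y.
  by rewrite /D !linearD addrACA.
move=> x /=; rewrite -/(D x); clearbody D.
have := D0 (x + D x); rewrite DD siDl// !siDr// !D0 (symD (D x)); lra.
Qed.

Lemma sq_normal_shift (N N' : {linear V -> V}) (l : R[i]) x :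
  (forall x y, g (N x) y = g x (N' y)) ->
  (forall x, g (N x) (N x) = g (N' x) (N' x)) ->
  g (N x - l *: x) (N x - l *: x) = g (N' x - l^*%C *: x) (N' x - l^*%C *: x).
Proof.
move=> adj nrm; have cross : g (N' x) (l^*%C *: x) = g (N x) (l *: x).
  by rewrite (siC hg) -adj linearZ/= si_conj// conjcK.
rewrite !sqB// nrm !sqZc// cross.
by case: l {cross} => a b /=; rewrite sqrrN.
Qed.

(** The last hypothesis places 0 in the closure of the numerical range of [N]. This forces [M >= 0]
    and supplies the starting vectors when [M = 0]. *)
Lemma normal_approx_eigenvalue (N N' : {linear V -> V}) (L : R) :
  (forall x y, g (N x) y = g x (N' y)) ->
  (forall x, g (N x) (N x) = g (N' x) (N' x)) ->
  (forall x, g (N x) (N x) <= L * g x x) ->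
  (forall h : R, 0 < h -> exists x, [/\ 0 < g x x, `|g (N x) x| <= h * g x x &
     `|g (N x) ('i%C *: x)| <= h * g x x]) ->
  exists M mu : R, [/\ 0 <= M, M = 0 -> 0 <= mu &
    forall e : R, 0 < e -> exists2 v, 0 < g v v &
      let d := N v - (M +i* mu)%C *: v in g d d <= e * g v v].
Proof.
move=> adj nrm NL approx.
have adj' x y : g (N' x) y = g x (N y) by rewrite (siC hg) -adj (siC hg).
have NN' := normal_commute adj nrm.
(* [X] and [Y] are the real and imaginary parts of [N]; [ih2] is [1 / (2i)]. *)
pose h2 : R[i] := (2^-1)%:C%C; pose ih2 : R[i] := (0 -i* 2^-1)%C.
pose X : {linear V -> V} := (h2 \*: N \+ h2 \*: N').
pose Y : {linear V -> V} := (ih2 \*: N \+ (- ih2) \*: N').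
have XE x : X x = h2 *: N x + h2 *: N' x by [].
have YE x : Y x = ih2 *: N x + (- ih2) *: N' x by [].
have XY : si_commute X Y.
  have XN : si_commute X N.
    by apply: si_commuteC; apply: si_commute_lin => //; exact: si_commute_refl.
  have XN' : si_commute X N'.
    apply: si_commuteC; apply: si_commute_lin; first exact: si_commuteC.
    exact: si_commute_refl.
  exact: si_commute_lin.
clearbody X Y.
have symX x y : g (X x) y = g x (X y).
  by rewrite !XE siDl// siDr// !siZl// !siZr// adj adj' addrC.
have ih2C : ih2^*%C = - ih2 by apply/eqP; rewrite eq_complex /= oppr0 !eqxx.
have symY x y : g (Y x) y = g x (Y y).
  rewrite !YE siDl// siDr// addrC !(si_conj hg _ (N _)) !(si_conj hg _ (N' _)).
  rewrite -[in (- ih2)^*%C]ih2C conjcK ih2C adj adj'.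
  by rewrite !linearZ/= addrC.
have NE x : N x = X x + 'i%C *: Y x.
  rewrite XE YE scalerDr !scalerA addrACA -!scalerDl.
  have -> : h2 + 'i%C * ih2 = 1.
    by apply/eqP; rewrite eq_complex /=; apply/andP; split; apply/eqP; field.
  have -> : h2 + 'i%C * - ih2 = 0.
    by apply/eqP; rewrite eq_complex /=; apply/andP; split; apply/eqP; field.
  by rewrite scale1r scale0r addr0.
have gX x : g (X x) x = g (N x) x.
  by rewrite XE siDl// !siZl// adj' (siC hg x); field.
have gY x : g (Y x) x = g (N x) ('i%C *: x).
  rewrite NE siDl// si_im// scalerA -expr2 sqr_i scaleN1r siNr// opprK.
  suff -> : g (X x) ('i%C *: x) = 0 by rewrite add0r.
  by have := symX x ('i%C *: x); rewrite linearZ (siC hg x) si_im//; lra.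
(* [L + 1] stands in for the square root of [L], since [L <= (L + 1) ^+ 2]. *)
pose D := L + 1.
have L_ge0 x : 0 < g x x -> 0 <= L.
  by move=> x0; rewrite -(pmulr_lge0 _ x0) (le_trans _ (NL x))// si_ge0.
have bound x y : g y y = g x x -> `|g (N x) y| <= D * g x x.
  move=> yx; have := si_ge0 hg x; rewrite le_eqVlt => /predU1P[x0|x0].
    by rewrite (siC hg) si_null// ?yx -x0 ?mulr0 ?normr0.
  have L0 := L_ge0 _ x0; rewrite -ler_sqr ?nnegrE ?mulr_ge0//; last 2 first.
  - by rewrite /D; lra.
  - exact: ltW.
  rewrite real_normK ?num_real// (le_trans (si_CauchySchwarz hg _ _))// yx.
  rewrite exprMn [g x x ^+ 2]expr2 mulrA ler_pM2r//.
  by rewrite (le_trans (NL x))// ler_pM2r// /D expr2; nra.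
have [x1 [x1_gt0 _ _]] := approx 1 ltr01; have L0 := L_ge0 _ x1_gt0.
pose W := [set r | exists x, 0 < g x x /\ r = g (N x) x / g x x].
have supW : has_sup W.
  split; first by exists (g (N x1) x1 / g x1 x1), x1.
  exists D => _ [x [x0 ->]]; rewrite ler_pdivrMr//.
  by rewrite (le_trans (ler_norm _))// bound.
pose M := sup W.
have WM x : g (N x) x <= M * g x x.
  have := si_ge0 hg x; rewrite le_eqVlt => /predU1P[x0|x0].
    by rewrite (siC hg) si_null// -x0 mulr0.
  by rewrite -ler_pdivrMr//; apply: ub_le_sup; [case: supW|exists x].
have M0 : 0 <= M.
  rewrite leNgt; apply/negP => M_lt0.
  have [|x [x0 hx _]] := approx (- M / 2); first by lra.
  have := WM x; move: hx; rewrite ler_norml => /andP[hx1 _] hx2.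
  have : M * g x x < 0 by rewrite pmulr_llt0.
  lra.
have MD : M <= D.
  apply: ge_sup; first by case: supW.
  move=> _ [x [x0 ->]]; rewrite ler_pdivrMr//.
  by rewrite (le_trans (ler_norm _))// bound.
pose P : {linear V -> V} := (M%:C%C \*: idfun \+ (-1) \*: X).
(* The shift by [D + 1] places the Rayleigh quotients of [Z] between 1 and [2 * D + 1]. *)
pose Z : {linear V -> V} := ((D + 1)%:C%C \*: idfun \+ 1 \*: Y).
have PZ : si_commute P Z.
  have YP : si_commute Y P.
    apply: si_commute_lin; first exact: si_commute_id.
    exact: si_commuteC.
  apply: si_commute_lin; first exact: si_commute_id.
  exact: si_commuteC.
have PE x : P x = M%:C%C *: x - X x by rewrite -scaleN1r.
have ZE x : Z x = (D + 1)%:C%C *: x + Y x by rewrite -[in RHS](scale1r (Y x)).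
clearbody P Z.
have D1 : 1 <= D by rewrite /D; lra.
have gZ x : g (Z x) x = (D + 1) * g x x + g (N x) ('i%C *: x).
  by rewrite ZE siDl// siZl// gY.
have gP x : g (P x) x = M * g x x - g (N x) x by rewrite PE siBl// siZl// gX.
have Zb x : - (D * g x x) <= g (N x) ('i%C *: x) <= D * g x x.
  by rewrite -ler_norml bound// sq_im.
have Zge x : g x x <= g (Z x) x by rewrite gZ; have /andP[? ?] := Zb x; lra.
have Zle x : g (Z x) x <= (D + D + 1) * g x x.
  by rewrite gZ; have /andP[? ?] := Zb x; lra.
have P0 x : 0 <= g (P x) x by rewrite gP subr_ge0.
have PB x : g (P x) x <= (D + D) * g x x.
  rewrite gP; have : `|g (N x) x| <= D * g x x by rewrite bound.
  rewrite ler_norml => /andP[? ?].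
  by have := ler_wpM2r (si_ge0 hg x) MD; lra.
have symZ : si_symmetric Z.
  by move=> x y; rewrite !ZE siDl// siDr// siZl// siZr// symY.
have symP : si_symmetric P.
  by move=> x y; rewrite !PE siBl// siBr// siZl// siZr// symX.
(* For [M = 0] the starting vectors nearly annihilate [Y] in mean, so [t >= D + 1], that is
   [mu >= 0]; otherwise the general lower bound 1 of [Z] suffices. *)
pose lo := if M == 0 then D + 1 else 1.
have [] := @joint_approx_eigenvalue _ _ _ hg P Z (D + D + 1) (D + D) lo => //.
- by lra.
- by lra.
- move=> h h0; rewrite /lo; have [M_eq0|Mn0] := eqVneq M 0.
    have [x [x0 hx1 hx2]] := approx h h0; exists x; split => //.
      by rewrite gP M_eq0 mul0r sub0r; move: hx1; rewrite ler_norml => /andP[? _]; lra.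
    by rewrite gZ; move: hx2; rewrite ler_norml => /andP[? _]; lra.
  have [_ [x [x0 ->]] hx] := sup_adherent h0 supW; exists x; split => //.
    by move: hx; rewrite -/M ltr_pdivlMr// gP => hx; lra.
  have := Zge x; have : 0 < h * g x x by rewrite mulr_gt0.
  lra.
move=> t lot tP; exists M, (t - (D + 1)); split => //.
  by move=> M_eq0; move: lot; rewrite /lo M_eq0 eqxx; lra.
move=> e e0; have [|v [v0 Zv Pv]] := tP (e / 4); first by rewrite divr_gt0.
exists v => //=; set d := _ - _.
have -> : d = - P v + 'i%C *: (Z v - t%:C%C *: v).
  rewrite /d NE PE ZE opprB.
  have -> : (M +i* (t - (D + 1)))%C = M%:C%C + 'i%C * (t%:C%C - (D + 1)%:C%C).
    by apply/eqP; rewrite eq_complex /=; apply/andP; split; apply/eqP; ring.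
  rewrite scalerDl -scalerA scalerBl opprD addrACA -scalerBr opprB.
  by congr (_ + _ *: _); rewrite addrA [Y v + _]addrC.
rewrite (le_trans (sqD_le hg _ _))// siNl// siNr// opprK sq_im//.
lra.
Qed.

End Normal.

(** * Hilbert spaces *)

Section HilbertBasics.
Context {R : realType} {H : hilbertType R}.
Implicit Types x y z : H.

Definition re_inner x y : R := complex.Re (inner x y).
Local Notation ip := re_inner.
Definition rnorm x : R := Num.sqrt (ip x x).

Lemma innerC x y : inner x y = (inner y x)^*%C.
Proof. by rewrite hermC expr0 mul1r. Qed.

Lemma semi_inner_re_inner : semi_inner ip.
Proof.
split; rewrite /ip.
- by move=> x y z; rewrite linearDl raddfD.
- by move=> t x y; rewrite linearZl_LR /=; case: (inner x y) => a b /=; rewrite mul0r subr0.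
- by move=> x y; rewrite innerC; case: (inner y x).
- move=> x; have : 0 <= inner x x by rewrite innerE exprn_ge0.
  by rewrite lecE => /andP[].
- move=> x y; rewrite linearZl_LR linearZr_LR /=; case: (inner x y) => a b /=; ring.
Qed.
Let hg := semi_inner_re_inner.

Lemma innerE_re x y : inner x y = (ip x y +i* ip x ('i%C *: y))%C.
Proof.
rewrite /ip linearZr_LR /=; case: (inner x y) => a b /=.
by apply/eqP; rewrite eq_complex /=; apply/andP; split; apply/eqP; ring.
Qed.

Lemma normE x : `|x| = (rnorm x)%:C%C.
Proof.
apply: (@pexpIrn _ 2) => //; rewrite ?nnegrE ?ler0c ?sqrtr_ge0//.
rewrite -innerE -rmorphXn/= sqr_sqrtr ?si_ge0// [LHS]innerE_re si_im_diag//.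
Qed.

Lemma rnorm_ge0 x : 0 <= rnorm x.
Proof. exact: sqrtr_ge0. Qed.

Lemma sqr_rnorm x : rnorm x ^+ 2 = ip x x.
Proof. by rewrite sqr_sqrtr// si_ge0. Qed.

Lemma rnormD x y : rnorm (x + y) <= rnorm x + rnorm y.
Proof. by rewrite -lecR rmorphD/= -!normE ler_normD. Qed.

Lemma rnormN x : rnorm (- x) = rnorm x.
Proof. by rewrite /rnorm siNl// siNr// opprK. Qed.

Lemma rnormB x y : rnorm (x - y) = rnorm (y - x).
Proof. by rewrite -rnormN opprB. Qed.

Lemma rnorm0 : rnorm 0 = 0.
Proof. by rewrite /rnorm si0l// sqrtr0. Qed.

Lemma rnorm_eq0 x : rnorm x = 0 -> x = 0.
Proof. by move=> x0; apply/normr0_eq0; rewrite normE x0. Qed.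

Lemma rnormZ (t : R) x : rnorm (t%:C%C *: x) = `|t| * rnorm x.
Proof. by rewrite /rnorm sqZ// sqrtrM ?sqr_ge0// sqrtr_sqr. Qed.

Lemma rnormZc (c : R[i]) x : rnorm (c *: x) = complex.Re `|c| * rnorm x.
Proof.
have := congr1 (@complex.Re R) (normE (c *: x)); rewrite normrZ normE.
by case: `|c| => a b /= <-; rewrite mulr0 subr0.
Qed.

Lemma re_inner_le x y : `|ip x y| <= rnorm x * rnorm y.
Proof.
rewrite -ler_sqr ?nnegrE ?mulr_ge0 ?rnorm_ge0//.
by rewrite real_normK ?num_real// exprMn !sqr_rnorm si_CauchySchwarz.
Qed.

Lemma re_inner_ext x y : (forall z, ip x z = ip y z) -> x = y.
Proof.
move=> xy; apply/eqP; rewrite -subr_eq0; apply/eqP/rnorm_eq0.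
by rewrite /rnorm siBl// xy subrr sqrtr0.
Qed.

Lemma hilbert_complete (u : nat -> H) (b : nat -> R) :
  (forall e : R, 0 < e -> exists n, b n < e) ->
  (forall n m, (n <= m)%N -> rnorm (u m - u n) <= b n) ->
  exists l, forall n, rnorm (l - u n) <= b n.
Proof.
move=> b0 ub.
have cu : cvg (u @ \oo).
  apply/cauchy_cvgP/cauchy_exP => e e0.
  have eE : e = (complex.Re e)%:C%C by rewrite RRe_real// gtr0_real.
  move: e0; rewrite eE ltcR => /b0[n bn]; exists (u n).
  exists n => // m nm; rewrite -ball_normE /= normE ltcR rnormB.
  exact: le_lt_trans (ub _ _ nm) bn.
exists (lim (u @ \oo)) => n; apply/ler_addgt0Pr => e e0.
have : 0 < e%:C%C :> R[i] by rewrite ltcR.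
move=> e0'; have [N _ NP] := cvgr_dist_lt _ _ cu _ e0'.
have := NP (maxn N n) (leq_maxl _ _); rewrite /= normE ltcR => h.
rewrite -(subrK (u (maxn N n)) (lim _)) -addrA (le_trans (rnormD _ _))// [leRHS]addrC.
by apply: lerD; [exact: ltW|rewrite ub ?leq_maxr].
Qed.

Definition pack_linear (T : H -> H) (linT : linear T) : {linear H -> H} :=
  HB.pack T (GRing.isLinear.Build _ _ _ _ T linT).

Lemma bounded_op_bound (T : H -> H) : bounded_op T ->
  exists2 C : R, 0 < C & forall x, rnorm (T x) <= C * rnorm x.
Proof.
move=> [linT cT].
have /linear_bounded_continuous/linear_boundedP : continuous (pack_linear linT) by [].
move=> /pinfty_ex_gt0[r r0 rP].
have rE : r = (complex.Re r)%:C%C by rewrite RRe_real// gtr0_real.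
exists (complex.Re r); first by move: r0; rewrite rE ltcR.
by move=> x; have := rP x; rewrite !normE rE -rmorphM lecR.
Qed.

Lemma bound_bounded_op (T : H -> H) (C : R) : linear T ->
  (forall x, rnorm (T x) <= C * rnorm x) -> bounded_op T.
Proof.
move=> linT TC; split => //.
have : continuous (pack_linear linT); last by [].
apply/linear_bounded_continuous/linear_boundedP.
exists C%:C%C; split; first by rewrite complex_real.
move=> r Cr x; rewrite (le_trans _ (ler_wpM2r _ (ltW Cr)))//.
by rewrite !normE -rmorphM lecR; exact: TC.
Qed.

End HilbertBasics.

(** * Riesz representation, adjoints and uniform boundedness *)

Section HilbertOperators.
Context {R : realType} {H : hilbertType R}.
Implicit Types x y z : H.
Local Notation ip := (@re_inner R H).
Let hg : semi_inner ip := semi_inner_re_inner.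

Lemma small_eq0 (w K : R) : (forall n : nat, `|w| <= K * n.+1%:R^-1) -> w = 0.
Proof.
move=> wK; apply/eqP; apply: contraT => w0; have w_gt0 : 0 < `|w| by rewrite normr_gt0.
have := wK (Num.truncn (K / `|w|)); rewrite ler_pdivlMr// mulrC.
by rewrite -ler_pdivlMr// leNgt truncnS_gt.
Qed.

Lemma rnorm_small_eq0 x (K : R) : (forall n : nat, rnorm x <= K * n.+1%:R^-1) -> x = 0.
Proof.
move=> xK; apply: rnorm_eq0; apply: (@small_eq0 _ K) => n.
by rewrite ger0_norm ?rnorm_ge0.
Qed.

Lemma invn_small (c e : R) : 0 < e -> exists n : nat, c * n.+1%:R^-1 < e.
Proof.
move=> e0; exists (Num.truncn (c / e)).
by rewrite ltr_pdivrMr// mulrC -ltr_pdivrMr// truncnS_gt.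
Qed.

(* [f] is represented by the minimizer of [|x|^2 - 2 f x]. *)
Lemma riesz_representation (f : H -> R) (C : R) :
  (forall x y, f (x + y) = f x + f y) ->
  (forall (t : R) x, f (t%:C%C *: x) = t * f x) ->
  (forall x, `|f x| <= C * rnorm x) ->
  exists z, forall x, f x = ip x z.
Proof.
move=> fD fZ fC; pose J x := ip x x - 2 * f x.
have J_lb x : - C ^+ 2 <= J x.
  have := fC x; rewrite ler_norml /J -sqr_rnorm => /andP[_ h].
  have := sqr_ge0 (rnorm x - C); rewrite sqrrB; lra.
have infJ : has_inf (range J).
  by split; [exists (J 0), 0|exists (- C ^+ 2) => _ [x _ <-]].
pose m := inf (range J).
have mJ x : m <= J x by apply: ge_inf; [case: infJ|exists x].
pose b n : R := n.+1%:R^-1.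
have b_gt0 n : 0 < b n by rewrite invr_gt0.
have /choice[u uP] : forall n, exists x, J x <= m + b n ^+ 2.
  move=> n; have [_ [x _ <-] /ltW hx] := inf_adherent (exprn_gt0 2 (b_gt0 n)) infJ.
  by exists x; exact: hx.
have fN x : f (- x) = - f x by have := fZ (-1) x; rewrite rmorphN1 scaleN1r mulN1r.
(* Comparing [J] at the midpoint with its infimum makes minimizing sequences Cauchy. *)
have parallelogram x y : ip (x - y) (x - y) <= 2 * (J x - m) + 2 * (J y - m).
  have := mJ ((2^-1)%:C%C *: (x + y)).
  rewrite /J sqZ// fZ fD sqD// sqB// => h; lra.
have [|n k nk|z zP] := @hilbert_complete _ _ u (fun n => 2 * b n).
- by move=> e e0; exact: invn_small.
- rewrite -ler_sqr ?nnegrE ?rnorm_ge0 ?mulr_ge0// ?(ltW (b_gt0 _))// sqr_rnorm.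
  rewrite (le_trans (parallelogram _ _))// exprMn.
  have bkn : b k ^+ 2 <= b n ^+ 2.
    by rewrite ler_sqr ?nnegrE ?(ltW (b_gt0 _))// lef_pV2 ?posrE// ler_nat.
  by have := uP n; have := uP k; lra.
exists z => y; apply/eqP; rewrite -subr_eq0; apply/eqP.
apply: (@small_eq0 _ (3 * rnorm y)) => n.
(* Near-minimality of [u n] along the direction [y] yields a nonnegative quadratic in [t], and its
   discriminant gives the bound. *)
have un : `|ip y (u n) - f y| <= b n * rnorm y.
  rewrite -ler_sqr ?nnegrE ?mulr_ge0 ?rnorm_ge0 ?(ltW (b_gt0 _))//.
  rewrite real_normK ?num_real// exprMn sqr_rnorm.
  apply: quadratic_discr_le; first exact: si_ge0.
  move=> t; have := mJ (u n + t%:C%C *: y); have := uP n.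
  by rewrite /J sqD// sqZ// siZr// fD fZ (siC hg y); lra.
have zn : `|ip y (z - u n)| <= rnorm y * (2 * b n).
  by rewrite (le_trans (re_inner_le _ _))// ler_wpM2l ?rnorm_ge0.
have -> : f y - ip y z = - (ip y (u n) - f y) - ip y (z - u n) by rewrite siBr//; ring.
rewrite (le_trans (ler_normB _ _))// normrN -/(b n); lra.
Qed.

(** [T] commutes with multiplication by [i], so an adjoint for the real part is already one for
    [inner]. *)
Lemma re_inner_linear_adjoint (T : {linear H -> H}) (S : H -> H) :
  (forall x y, ip (T x) y = ip x (S y)) ->
  linear S /\ forall x y, inner (T x) y = inner x (S y).
Proof.
move=> TS; split => [a y z|x y].
  apply: re_inner_ext => x; rewrite (siC hg _ x) (siC hg _ x) -TS siDr// siDr//.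
  by rewrite -!(TS x) -[a]conjcK -!si_conj// -TS linearZ.
rewrite !innerE_re TS; congr Complex.
by apply: oppr_inj; rewrite -!(si_im hg) -TS linearZ.
Qed.

(** Riesz represents [x |-> ip (T x) y] by a vector [S y], and [ip (S y) (S y) = ip (T (S y)) y]
    gives [S] the same bound as [T]. *)
Lemma adjointP (T : H -> H) : bounded_op T ->
  bounded_op (adjoint T) /\ forall x y, inner (T x) y = inner x (adjoint T y).
Proof.
move=> bT; have [C C0 TC] := bounded_op_bound bT.
have [linT _] := bT; pose L := pack_linear linT.
apply: (@xgetPex _ (cst 0) [set S : H -> H |
    bounded_op S /\ forall x y, inner (T x) y = inner x (S y)]).
have /choice[S SP] : forall y, exists z, forall x, ip (L x) y = ip x z.
  move=> y; apply: (@riesz_representation _ (C * rnorm y)).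
  - by move=> x x'; rewrite linearD siDl.
  - by move=> t x; rewrite linearZ siZl.
  - move=> x; rewrite (le_trans (re_inner_le _ _))// mulrAC.
    by rewrite ler_wpM2r ?rnorm_ge0.
have [linS TS] := re_inner_linear_adjoint (fun x y => SP y x).
exists S; split => //; apply: (@bound_bounded_op _ _ _ C) => // y.
have := rnorm_ge0 (S y); rewrite le_eqVlt => /predU1P[<-|S0].
  by rewrite mulr_ge0 ?rnorm_ge0// ltW.
rewrite -(ler_pM2r S0) -expr2 sqr_rnorm -SP (le_trans (ler_norm _))//.
rewrite (le_trans (re_inner_le _ _))// mulrAC ler_wpM2r ?rnorm_ge0//.
Qed.

(* Sokal's proof: the points [x n] move by [3^-n] in the direction of [w n]. *)
Lemma uniform_boundedness (F : set H) :
  (forall y, exists C, forall w, F w -> `|ip y w| <= C) ->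
  exists C, forall w, F w -> rnorm w <= C.
Proof.
move=> ptF; apply: contrapT => nF.
pose b n : R := 3^-1 ^+ n.
have b_gt0 n : 0 < b n by rewrite exprn_gt0.
have /choice[w wP] : forall n : nat, exists w, F w /\ n%:R / b n < rnorm w.
  move=> n; apply: contrapT => nw; apply: nF; exists (n%:R / b n) => w Fw.
  by rewrite leNgt; apply/negP => h; apply: nw; exists w.
have w_gt0 n : 0 < rnorm (w n).
  by apply: le_lt_trans (wP n).2; rewrite divr_ge0// ltW.
(* With this sign the step reinforces [ip (x n) (w n)], so the new value against [w n] is at least
   [rnorm (w n) * b n] in modulus. *)
pose s x n : R := if 0 <= ip x (w n) then 1 else -1.
pose x := fix x n : H := if n is k.+1
  then x k + (s (x k) k * b k / rnorm (w k))%:C%C *: w k else 0.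
have xS n : x n.+1 = x n + (s (x n) n * b n / rnorm (w n))%:C%C *: w n by [].
have step n : rnorm (x n.+1 - x n) = b n.
  rewrite xS addrC addKr rnormZ normrM normrM (gtr0_norm (b_gt0 n)).
  rewrite [`|_^-1|]gtr0_norm ?invr_gt0// divfK ?gt_eqF//.
  by rewrite /s; case: ifP => _; rewrite ?normrN normr1 mul1r.
have bS n : b n.+1 = b n / 3 by rewrite /b exprSr.
have tail n k : rnorm (x (n + k)%N - x n) <= 3 / 2 * (b n - b (n + k)%N).
  elim: k => [|k IH]; first by rewrite addn0 !subrr rnorm0 mulr0.
  rewrite addnS -(subrK (x (n + k)%N) (x _.+1)) -addrA (le_trans (rnormD _ _))//.
  by rewrite step bS; lra.
have [|n k nk|l lP] := @hilbert_complete _ _ x (fun n => 3 / 2 * b n).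
- move=> e e0; have [n hn] := invn_small (3 / 2) e0; exists n.
  apply: le_lt_trans hn; rewrite ler_pM2l// /b exprVn lef_pV2 ?posrE ?exprn_gt0//.
  elim: n => [//|n IH]; rewrite exprS -natr1.
  by have : 1 <= n.+1%:R :> R; [rewrite ler1n|lra].
- rewrite -(subnKC nk) (le_trans (tail _ _))//.
  by have := b_gt0 (n + (k - n))%N; lra.
have [C CP] := ptF l; have [n] : exists n : nat, 2 * `|C| < n%:R.
  by exists (Num.truncn (2 * `|C|)).+1; exact: truncnS_gt.
have [Fw wn] := wP n; move: wn; rewrite ltr_pdivrMr// => wn.
have big : rnorm (w n) * b n <= `|ip (x n.+1) (w n)|.
  rewrite xS siDl// siZl// -sqr_rnorm expr2 mulrA divfK ?gt_eqF//.
  have := b_gt0 n; have := w_gt0 n; move: (rnorm _) (b n) => p q p0 q0.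
  have pq : 0 < p * q by rewrite mulr_gt0.
  rewrite /s; case: ifPn => [h|]; first by rewrite ger0_norm; nra.
  by rewrite -ltNge => h; rewrite ltr0_norm; nra.
(* All later steps total at most [3 / 2 * b n.+1 = b n / 2] and undo at most half of that gain,
   which exceeds [n > 2 * |C|]. *)
have near_l : `|ip (l - x n.+1) (w n)| <= 2^-1 * b n * rnorm (w n).
  rewrite (le_trans (re_inner_le _ _))// ler_wpM2r ?rnorm_ge0//.
  by rewrite (le_trans (lP _))// bS; lra.
have := CP _ Fw; have := ler_norm C.
have : `|ip (x n.+1) (w n)| <= `|ip l (w n)| + `|ip (l - x n.+1) (w n)|.
  by rewrite siBl// -[X in `|X| <= _](subKr (ip l (w n))) ler_normB.
lra.
Qed.

End HilbertOperators.

(** * Positive square roots *)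

Section SquareRoot.
Context {R : realType} {H : hilbertType R}.
Implicit Types x y z : H.
Local Notation ip := (@re_inner R H).
Let hg : semi_inner ip := semi_inner_re_inner.

(** Positivity makes every [inner (A x) x] real; symmetry follows by polarization at
    [x - 'i%C *: y]. *)
Lemma positive_op_symmetric (A : H -> H) : positive_op A -> si_symmetric ip A.
Proof.
move=> [[linA _] A0]; pose L := pack_linear linA.
have Aim x : ip (L x) ('i%C *: x) = 0.
  by have := A0 x; rewrite innerE_re lecE => /andP[/eqP].
suff sym x y : ip (L x) y = ip x (L y) by [].
have := Aim (x - 'i%C *: y); rewrite scalerBr scalerA -expr2 sqr_i scaleN1r opprK.
rewrite linearB siBl// !siDr// Aim linearZ !si_im// opprD scalerA -expr2 sqr_i.
rewrite scaleN1r siNr// Aim (siC hg x); lra.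
Qed.

Lemma symmetric_positive_op (A : {linear H -> H}) : continuous A ->
  si_symmetric ip A -> (forall x, 0 <= ip (A x) x) -> positive_op A.
Proof.
move=> cA symA A0; split; first by split => //; exact: linearP.
move=> x; rewrite innerE_re lecE /= A0 andbT; apply/eqP.
by have := symA x ('i%C *: x); rewrite linearZ (siC hg x) si_im//; lra.
Qed.

Lemma positive_re_inner_ge0 (A : H -> H) x : positive_op A -> 0 <= ip (A x) x.
Proof. by move=> [_ /(_ x)]; rewrite lecE => /andP[]. Qed.

Section Iteration.
Variable C : {linear H -> H}.
Hypothesis symC : si_symmetric ip C.
Hypothesis C_le1 : forall x, rnorm (C x) <= rnorm x.

(* The iterates solve [2 Y = C + Y^2] in the limit, i.e. [(1 - Y)^2 = 1 - C];
   they are dominated by the scalar iterates for [C = 1], which tend to 1. *)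
Fixpoint sqrt_iter n : {linear H -> H} :=
  if n is k.+1 then (2^-1)%:C%C \*: (C \+ (sqrt_iter k \o sqrt_iter k))
  else \0.
Fixpoint sqrt_scal n : R :=
  if n is k.+1 then 2^-1 * (1 + sqrt_scal k ^+ 2) else 0.

Local Notation Y := sqrt_iter.
Local Notation y := sqrt_scal.

Lemma sqrt_iterS n x : Y n.+1 x = (2^-1)%:C%C *: (C x + Y n (Y n x)).
Proof. by []. Qed.

Lemma sqrt_scalS n : y n.+1 = 2^-1 * (1 + y n ^+ 2).
Proof. by []. Qed.

Lemma sqrt_scal_itv n : 0 <= y n <= 1.
Proof.
elim: n => [|n /andP[h0 h1]]; first by rewrite lexx ler01.
by rewrite sqrt_scalS; apply/andP; split; nra.
Qed.

Lemma sqrt_scal_mono n m : (n <= m)%N -> y n <= y m.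
Proof.
move=> /subnKC <-; elim: (m - n)%N => [|k IH]; first by rewrite addn0.
rewrite (le_trans IH)// addnS sqrt_scalS.
have := sqr_ge0 (1 - y (n + k)); nra.
Qed.

(** With [u = 1 - y n] the recursion is [u - u ^+ 2 / 2], increasing for [u <= 1]; the sharper bound
    [2 / (n + 2)] is the one that the induction preserves. *)
Lemma sqrt_scal_cvg n : 1 - y n <= 2 * n.+1%:R^-1.
Proof.
suff : 1 - y n <= 2 / (n%:R + 2).
  move=> h; have n0 : 0 <= n%:R :> R by [].
  by rewrite (le_trans h)// ler_pM2l// lef_pV2 ?posrE -?natr1; lra.
elim: n => [|n IH]; first by rewrite /= subr0 add0r divff.
have n0 : 0 <= n%:R :> R by [].
have d0 : 0 < n%:R + 2 :> R by lra.
have d1 : 0 < n%:R + 3 :> R by lra.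
rewrite sqrt_scalS -[n.+1%:R]natr1 (_ : n%:R + 1 + 2 = n%:R + 3); last by ring.
have /andP[y0 y1] := sqrt_scal_itv n.
set c := 2 / (n%:R + 2) in IH.
have c1 : c <= 1 by rewrite ler_pdivrMr//; lra.
apply: (@le_trans _ _ (c - c ^+ 2 / 2)).
  have : 0 <= (c - (1 - y n)) * (2 - c - (1 - y n)) by rewrite mulr_ge0//; lra.
  by nra.
rewrite -subr_ge0 (_ : _ - _ = 2 / ((n%:R + 3) * (n%:R + 2) ^+ 2)); last first.
  by rewrite /c; field; rewrite !gt_eqF.
by rewrite divr_ge0// mulr_ge0 ?sqr_ge0// ltW.
Qed.

Lemma sqrt_iter_le n x : rnorm (Y n x) <= y n * rnorm x.
Proof.
elim: n x => [|n IH] x; first by rewrite /= rnorm0 mul0r.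
rewrite sqrt_iterS rnormZ ger0_norm ?invr_ge0// sqrt_scalS -mulrA.
rewrite ler_pM2l ?invr_gt0// mulrDl mul1r (le_trans (rnormD _ _))//.
rewrite lerD// (le_trans (IH _))// expr2 -mulrA ler_wpM2l//.
by have /andP[] := sqrt_scal_itv n.
Qed.

Lemma sqrt_iter_le1 n x : rnorm (Y n x) <= rnorm x.
Proof.
rewrite (le_trans (sqrt_iter_le n x))// ler_piMl ?rnorm_ge0//.
by have /andP[] := sqrt_scal_itv n.
Qed.

Lemma sqrt_iterC n x : C (Y n x) = Y n (C x).
Proof.
elim: n x => [|n IH] x; first by rewrite linear0.
by rewrite !sqrt_iterS linearZ/= linearD !IH.
Qed.

Lemma sqrt_iter_step_comm n x : Y n.+1 (Y n x) = Y n (Y n.+1 x).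
Proof. by rewrite !sqrt_iterS linearZ/= (linearD (Y n)) sqrt_iterC. Qed.

(** Consecutive iterates commute, so the next difference is half of [(Y n.+1 + Y n)] applied to the
    present one; the scalar iterates satisfy the same identity. *)
Lemma sqrt_iter_step n x : rnorm (Y n.+1 x - Y n x) <= (y n.+1 - y n) * rnorm x.
Proof.
elim: n x => [|n IH] x.
  have -> : y 1 - y 0 = 2^-1 by rewrite /= expr0n/= addr0 mulr1 subr0.
  rewrite sqrt_iterS /= addr0 subr0 rnormZ ger0_norm ?invr_ge0//.
  by rewrite ler_pM2l ?invr_gt0.
set d := Y n.+1 x - Y n x.
have -> : Y n.+2 x - Y n.+1 x = (2^-1)%:C%C *: (Y n.+1 d + Y n d).
  rewrite (sqrt_iterS n.+1) [X in _ - X = _]sqrt_iterS -scalerBr opprD addrACA subrr add0r.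
  congr (_ *: _); rewrite /d (linearB (Y n.+1)) (linearB (Y n)) sqrt_iter_step_comm addrA.
  by rewrite subrK.
rewrite rnormZ ger0_norm ?invr_ge0//.
have -> : y n.+2 - y n.+1 = 2^-1 * ((y n.+1 + y n) * (y n.+1 - y n)).
  by rewrite (sqrt_scalS n.+1) [X in _ - X = _]sqrt_scalS; ring.
rewrite -mulrA ler_pM2l ?invr_gt0// (le_trans (rnormD _ _))//.
rewrite (le_trans (lerD (sqrt_iter_le _ _) (sqrt_iter_le _ _)))// -mulrDl -mulrA.
have /andP[y0 _] := sqrt_scal_itv n; have /andP[y1 _] := sqrt_scal_itv n.+1.
by apply: ler_wpM2l (IH x); rewrite addr_ge0.
Qed.

Lemma sqrt_iter_cauchy n m x : (n <= m)%N ->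
  rnorm (Y m x - Y n x) <= (y m - y n) * rnorm x.
Proof.
move=> /subnKC <-; elim: (m - n)%N => [|k IH].
  by rewrite addn0 !subrr mul0r rnorm0.
rewrite addnS -(subrK (Y (n + k)%N x) (Y _.+1 x)) -addrA (le_trans (rnormD _ _))//.
by rewrite (le_trans (lerD (sqrt_iter_step _ _) IH))// -mulrDl addrA subrK.
Qed.

Lemma sqrt_iter_symmetric n : si_symmetric ip (Y n).
Proof.
elim: n => [|n IH] x z; first by rewrite /= (siC hg x) !si0l.
by rewrite !sqrt_iterS siZl// siZr// siDl// siDr// symC !IH.
Qed.

(** The scalar rate gives pointwise convergence; linearity, symmetry and the fixed-point equation
    hold for the limit because their defects are at most multiples of [1 / (n + 1)]. *)
Lemma sqrt_iter_limit : exists Z : {linear H -> H},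
  [/\ forall x, rnorm (Z x) <= rnorm x, si_symmetric ip Z &
      forall x, Z x = (2^-1)%:C%C *: (C x + Z (Z x))].
Proof.
pose e n : R := n.+1%:R^-1; have e_ge0 n : 0 <= e n by rewrite invr_ge0.
have /choice[Z ZP] : forall x, exists l, forall n, rnorm (l - Y n x) <= (1 - y n) * rnorm x.
  move=> x; apply: (@hilbert_complete _ _ (fun n => Y n x)).
    move=> c c0; have [n hn] := invn_small (2 * rnorm x) c0; exists n.
    apply: le_lt_trans hn; rewrite mulrAC ler_wpM2r ?rnorm_ge0//.
    exact: sqrt_scal_cvg.
  move=> n m nm; rewrite (le_trans (sqrt_iter_cauchy x nm))//.
  rewrite ler_wpM2r ?rnorm_ge0// lerD2r.
  by have /andP[] := sqrt_scal_itv m.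
have Ze n x : rnorm (Z x - Y n x) <= 2 * rnorm x * e n.
  by rewrite (le_trans (ZP x n))// mulrAC ler_wpM2r ?rnorm_ge0// sqrt_scal_cvg.
have linZ : linear Z.
  move=> a x z; apply/eqP; rewrite -subr_eq0; apply/eqP.
  apply: (@rnorm_small_eq0 _ _ _ (2 * (rnorm (a *: x + z) +
    (complex.Re `|a| * rnorm x + rnorm z)))) => n; rewrite -/(e n).
  have -> : Z (a *: x + z) - (a *: Z x + Z z) =
      (Z (a *: x + z) - Y n (a *: x + z)) - (a *: (Z x - Y n x) + (Z z - Y n z)).
    by rewrite linearP scalerBr addrACA -opprD opprB addrA subrK.
  rewrite (le_trans (rnormD _ _))// rnormN mulrDr mulrDl lerD//.
  rewrite (le_trans (rnormD _ _))// mulrDr mulrDl lerD// rnormZc.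
  rewrite mulrCA -mulrA ler_wpM2l//.
  by have : 0 <= `|a| by []; rewrite lecE => /andP[].
have Z_le1 x : rnorm (Z x) <= rnorm x.
  by have := ZP x 0%N; rewrite /= !subr0 mul1r.
exists (pack_linear linZ); split => [//|x z|x] /=.
- apply/eqP; rewrite -subr_eq0; apply/eqP.
  apply: (@small_eq0 _ _ (4 * (rnorm x * rnorm z))) => n; rewrite -/(e n).
  have -> : ip (Z x) z - ip x (Z z) = ip (Z x - Y n x) z - ip x (Z z - Y n z).
    by rewrite siBl// siBr// sqrt_iter_symmetric; ring.
  rewrite (le_trans (ler_normB _ _))//.
  have := re_inner_le (Z x - Y n x) z; have := re_inner_le x (Z z - Y n z).
  have := ler_wpM2l (rnorm_ge0 x) (Ze n z).
  have := ler_wpM2r (rnorm_ge0 z) (Ze n x).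
  lra.
- apply/eqP; rewrite -subr_eq0; apply/eqP.
  apply: (@rnorm_small_eq0 _ _ _ (4 * rnorm x)) => n; rewrite -/(e n).
  have -> : Z x - (2^-1)%:C%C *: (C x + Z (Z x)) = (Z x - Y n.+1 x) -
     (2^-1)%:C%C *: ((Z (Z x) - Y n (Z x)) + Y n (Z x - Y n x)).
    rewrite sqrt_iterS linearB addrA subrK -addrA -opprD -scalerDr.
    by rewrite -addrA [_ + (Z (Z x) - _)]addrC subrK.
  rewrite (le_trans (rnormD _ _))// rnormN rnormZ ger0_norm ?invr_ge0//.
  have := rnormD (Z (Z x) - Y n (Z x)) (Y n (Z x - Y n x)).
  have := sqrt_iter_le1 n (Z x - Y n x); have := Ze n x; have := Ze n (Z x).
  have : rnorm (Z x - Y n.+1 x) <= 2 * rnorm x * e n.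
    rewrite (le_trans (ZP _ _))// mulrAC ler_wpM2r ?rnorm_ge0//.
    by rewrite (le_trans _ (sqrt_scal_cvg n))// lerD2l lerN2 sqrt_scal_mono.
  have := ler_wpM2r (e_ge0 n) (Z_le1 x).
  lra.
Qed.

End Iteration.

(** If [c] bounds [A], then [C = 1 - A / c] lies between 0 and 1. The fixed point [Z] satisfies
    [(1 - Z)^2 = 1 - C = A / c], and [1 - Z] is positive because [Z] is a contraction. *)
Lemma positive_sqrt_exists (A : H -> H) : positive_op A ->
  exists Q, positive_op Q /\ Q \o Q = A.
Proof.
move=> posA; have [bA _] := posA; have [c c0 Ac] := bounded_op_bound bA.
have [linA _] := bA; have symA := positive_op_symmetric posA.
pose C : {linear H -> H} := (idfun \+ (- c^-1)%:C%C \*: pack_linear linA).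
have CE x : C x = x - (c^-1)%:C%C *: A x by rewrite /= rmorphN scaleNr.
clearbody C.
have symC : si_symmetric ip C.
  by move=> x z; rewrite !CE siBl// siBr// siZl// siZr// symA.
have C0 x : 0 <= ip (C x) x.
  rewrite CE siBl// siZl// subr_ge0 ler_pdivrMl// -sqr_rnorm expr2 mulrA.
  rewrite (le_trans (ler_norm _))// (le_trans (re_inner_le _ _))//.
  by rewrite ler_wpM2r ?rnorm_ge0.
have C1 x : ip (C x) x <= 1 * ip x x.
  rewrite mul1r CE siBl// siZl// gerBl mulr_ge0 ?invr_ge0 ?(ltW c0)//.
  exact: positive_re_inner_ge0.
have C_le1 x : rnorm (C x) <= rnorm x.
  rewrite -ler_sqr ?nnegrE ?rnorm_ge0// !sqr_rnorm.
  by have := positive_op_sq_le hg ler01 symC C0 C1 x; have := C1 x; lra.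
have [Z [Z1 symZ ZE]] := sqrt_iter_limit symC C_le1.
pose Q : {linear H -> H} := ((Num.sqrt c)%:C%C \*: (idfun \+ (-1) \*: Z)).
have QE x : Q x = (Num.sqrt c)%:C%C *: (x - Z x) by rewrite /= scaleN1r.
clearbody Q.
exists Q; split.
  apply: symmetric_positive_op => [|x z|x].
  - suff [] : bounded_op Q by [].
    apply: (@bound_bounded_op _ _ _ (Num.sqrt c * 2)) => [|x]; first exact: linearP.
    rewrite QE rnormZ ger0_norm ?sqrtr_ge0// -mulrA ler_wpM2l ?sqrtr_ge0//.
    by rewrite (le_trans (rnormD _ _))// rnormN; have := Z1 x; lra.
  - by rewrite !QE siZl// siZr// siBl// siBr// symZ.
  - rewrite QE siZl// mulr_ge0 ?sqrtr_ge0// siBl// subr_ge0 -sqr_rnorm expr2.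
    rewrite (le_trans (ler_norm _))// (le_trans (re_inner_le _ _))//.
    by rewrite ler_wpM2r ?rnorm_ge0.
apply/funext => x /=.
rewrite 2!QE linearZ/= -scalerBr scalerA.
rewrite -rmorphM -expr2 sqr_sqrtr ?(ltW c0)//.
have Zx : Z (Z x) = 2%:C%C *: Z x - C x.
  rewrite [in RHS]ZE scalerA -rmorphM divff// scale1r.
  by rewrite addrC addKr.
rewrite (linearB Z) Zx CE.
have -> : x - Z x - (Z x - (2%:C%C *: Z x - (x - (c^-1)%:C%C *: A x))) =
    (c^-1)%:C%C *: A x.
  rewrite rmorphD scalerDl scale1r opprB.
  by rewrite [_ + _ - _ - Z x]addrAC addrK addrA subrK subKr.
by rewrite scalerA -rmorphM divff ?gt_eqF// scale1r.
Qed.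

Lemma sqrt_opP (A : H -> H) : positive_op A ->
  positive_op (sqrt_op A) /\ sqrt_op A \o sqrt_op A = A.
Proof.
move=> posA.
exact: (@xgetPex _ (cst 0) [set Q : H -> H | positive_op Q /\ Q \o Q = A]
  (positive_sqrt_exists posA)).
Qed.

(** This is one direction of Douglas' theorem. If [adjoint S (Q y) = Q y'], then
    [ip y (Q (S x)) = ip y' (Q x)], so the vectors [Q (S x)] with [rnorm (Q x) <= 1] are weakly
    bounded, hence bounded. *)
Lemma B_sqrtA_bounded (A S : H -> H) : positive_op A -> B_sqrtA A S ->
  exists2 d : R, 0 < d & forall x, ip (A (S x)) (S x) <= d * ip (A x) x.
Proof.
move=> posA [bS rangeS]; have [posQ QQ] := sqrt_opP posA.
move: rangeS posQ QQ; set Q := sqrt_op A => rangeS posQ QQ.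
have symQ := positive_op_symmetric posQ.
have AE x : ip (A x) x = rnorm (Q x) ^+ 2.
  by rewrite sqr_rnorm -QQ /= symQ.
have [linS _] := bS; have [[linQ _] _] := posQ.
have [_ adjS] := adjointP bS.
pose S' := pack_linear linS; pose Q' := pack_linear linQ.
pose F := [set w | exists x, rnorm (Q x) <= 1 /\ w = Q (S x)].
have [y|C CP] := @uniform_boundedness _ _ F.
  have [y' _ Qy'] : range Q (adjoint S (Q y)) by apply: rangeS; exists y.
  exists (rnorm y') => _ [x [Qx ->]].
  rewrite -symQ (siC hg) /re_inner adjS -Qy' -/(re_inner _ _) -symQ.
  rewrite (le_trans (re_inner_le _ _))// ler_piMl ?rnorm_ge0//.
pose D := `|C| + 1; have D0 : 0 < D by rewrite ltr_wpDl.
have SD x : rnorm (Q (S x)) <= D * rnorm (Q x).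
  (* Testing all scales [t] also covers [Q x = 0], where [t] is unrestricted. *)
  have scaled t : 0 < t -> t * rnorm (Q x) <= 1 -> t * rnorm (Q (S x)) <= D.
    move=> t0 tQ; have := CP (Q (S (t%:C%C *: x))).
    rewrite -[S _]/(S' _) linearZ -[Q _]/(Q' _) linearZ rnormZ (gtr0_norm t0).
    move=> h; have := ler_norm C; suff : t * rnorm (Q (S x)) <= C by rewrite /D; lra.
    apply: h; exists (t%:C%C *: x); split.
      by rewrite -[Q _]/(Q' _) linearZ rnormZ (gtr0_norm t0).
    by rewrite -[S (_ *: _)]/(S' _) linearZ -[Q (_ *: _)]/(Q' _) linearZ.
  have := rnorm_ge0 (Q x); rewrite le_eqVlt => /predU1P[Qx0|Qx0]; last first.
    have := scaled (rnorm (Q x))^-1; rewrite invr_gt0 mulVf ?gt_eqF// => /(_ Qx0 (lexx _)).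
    by rewrite ler_pdivrMl// mulrC.
  rewrite -Qx0 mulr0 leNgt; apply/negP => QS0.
  have := scaled ((D + 1) / rnorm (Q (S x))).
  rewrite -Qx0 mulr0 divfK ?gt_eqF// (divr_gt0 (addr_gt0 D0 ltr01) QS0).
  by move=> /(_ isT ler01); lra.
exists (D ^+ 2) => [|x]; first by rewrite exprn_gt0.
rewrite !AE -exprMn ler_sqr ?nnegrE ?rnorm_ge0//.
by rewrite mulr_ge0 ?rnorm_ge0// ltW.
Qed.

End SquareRoot.

(** * A-normal operators *)

Section ANormal.
Context {R : realType} {H : hilbertType R} (A T : H -> H).
Hypotheses (posA : positive_op A) (bT : bounded_op T).
Local Notation ip := (@re_inner R H).
Let hg : semi_inner ip := semi_inner_re_inner.

Definition re_inner_A (x y : H) : R := ip (A x) y.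
Local Notation g := re_inner_A.

Let linA : linear A. Proof. by case: posA => -[]. Qed.
Let linT : linear T. Proof. by case: bT. Qed.

Lemma semi_inner_A : semi_inner g.
Proof.
apply: (@semi_inner_op _ _ _ hg (pack_linear linA)).
  exact: positive_op_symmetric.
by move=> x; exact: positive_re_inner_ge0.
Qed.
Let hA := semi_inner_A.

Lemma inner_A_re x y : inner_A A x y = (g x y +i* g x ('i%C *: y))%C.
Proof. exact: innerE_re. Qed.

Lemma norm_A_sq x y : norm_A A x = norm_A A y -> g x x = g y y.
Proof.
move=> xy; have : norm_A A x ^+ 2 = norm_A A y ^+ 2 by rewrite xy.
by rewrite /norm_A !sqrtCK !inner_A_re => -[].
Qed.

Lemma norm_A_eq1 x : norm_A A x = 1 -> inner_A A x x = 1.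
Proof. by move=> x1; rewrite -[LHS]sqrtCK -/(norm_A A x) x1 expr1n. Qed.

(* If no operator satisfies the equations defining [sharp A T], then [sharp A T]
   is 0 and A-normality forces [A T = 0], so 0 is again an A-adjoint of [T]. *)
Lemma A_normal_adjoint : A_normal A T -> exists U : {linear H -> H},
  (forall x y, g (T x) y = g x (U y)) /\ forall x, g (T x) (T x) = g (U x) (U x).
Proof.
move=> nT; have nTg x : g (T x) (T x) = g (sharp A T x) (sharp A T x).
  exact: norm_A_sq.
pose P := [set S : H -> H |
  [/\ bounded_op S, adjoint T \o A = A \o S & range S `<=` closure (range A)]].
have [exS|nS] := pselect (exists S, P S).
  have : P (sharp A T) by exact: xgetPex exS.
  move=> [[linS _] AS _].
  exists (pack_linear linS); split => // x y.
  have [_ adjT] := adjointP bT.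
  have ASy : adjoint T (A y) = A (sharp A T y) by rewrite -[LHS]/((adjoint T \o A) y) AS.
  rewrite /re_inner_A positive_op_symmetric// /re_inner adjT ASy.
  by rewrite -/(re_inner _ _) -positive_op_symmetric.
have sharp0 : sharp A T = cst 0 by apply: xgetPN => S SP; apply: nS; exists S.
exists \0; split => [x y|x]; last by rewrite nTg sharp0.
by rewrite (si_null hA) ?nTg ?sharp0 ?si0l// (siC hA) si0l.
Qed.

Section Adjoint.
Variable U : {linear H -> H}.
Hypothesis adjU : forall x y, g (T x) y = g x (U y).
Hypothesis normU : forall x, g (T x) (T x) = g (U x) (U x).

(** Cauchy-Schwarz on [g (T x) (T x) = g x (U (T x))], with [normU], gives log-convexity along
    orbits. Their growth is controlled by the ordinary operator bound [C], whence the constant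
    [C ^+ 2]. *)
Lemma A_normal_bounded : exists2 c : R, 0 < c & forall x, g (T x) (T x) <= c * g x x.
Proof.
have [C C0 TC] := bounded_op_bound bT.
have [B B0 AB] := bounded_op_bound posA.1.
exists (C ^+ 2); first by rewrite exprn_gt0.
apply: (log_convex_bound hA) => [|x|x]; first by rewrite exprn_gt0.
  by rewrite {1}adjU (normU (T x)) si_CauchySchwarz.
exists (B * rnorm x ^+ 2) => n; rewrite -exprM mulnC exprM -mulrA -exprMn.
have Tn : rnorm (iter n T x) <= rnorm x * C ^+ n.
  elim: n => [|n IH]; first by rewrite mulr1.
  rewrite iterS (le_trans (TC _))// exprS mulrCA.
  by rewrite ler_pM2l.
rewrite (le_trans (ler_norm _))// (le_trans (re_inner_le _ _))//.
apply: (@le_trans _ _ (B * rnorm (iter n T x) ^+ 2)).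
  by rewrite expr2 mulrA ler_wpM2r ?rnorm_ge0.
by rewrite ler_pM2l// lerXn2r ?nnegrE ?rnorm_ge0// mulr_ge0 ?rnorm_ge0// exprn_ge0// ltW.
Qed.

End Adjoint.

(** An A-inverse [S] of [l - T] is bounded for [g] by some [d], and [A S (l - T) = A] turns this
    into a lower bound for [l - T], contradicted by [e = 1 / (2 d)]. *)
Lemma approx_eigenvalue_spectrum (l : R[i]) :
  (forall e : R, 0 < e -> exists2 v, 0 < g v v &
    let d := T v - l *: v in g d d <= e * g v v) ->
  spectrum_A A T l.
Proof.
move=> approx [_ _ [S [BS _ _ ASlT]]].
have [d d0 Sd] := B_sqrtA_bounded posA BS.
have [|v v0 /= dv] := approx (d^-1 / 2); first by rewrite divr_gt0 ?invr_gt0.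
have AS : A (S (l *: v - T v)) = A v by rewrite -[RHS](congr1 (@^~ v) ASlT).
have := Sd (l *: v - T v).
rewrite AS (positive_op_symmetric posA v) AS (siC hg v) -/(g v v).
rewrite -/(g (l *: v - T v) _) -opprB (siNl hA) (siNr hA) opprK => h.
have : d * g (T v - l *: v) (T v - l *: v) <= d * (d^-1 / 2 * g v v).
  by rewrite ler_pM2l.
rewrite !mulrA divff ?gt_eqF//; lra.
Qed.

End ANormal.

(** * From the numerical range to the hull of the spectrum *)

Lemma closure_approx (R : realType) (D : set R[i]^o) (z : R[i]) (h : R) :
  closure D z -> 0 < h -> exists2 w : R[i], D w & `|z - w| < h%:C%C.
Proof.
move=> Dz h0; have h0' : 0 < h%:C%C :> R[i] by rewrite ltcR.
have [w [Dw]] := Dz _ (nbhsx_ballx (z : R[i]^o) _ h0').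
by rewrite -ball_normE => zw; exists w.
Qed.

Theorem theorem4p11 (R : realType) (H : hilbertType R) (A T : H -> H)
  (A_pos : positive_op A) (A_neq0 : A <> cst 0)
  (T_BA : B_A A T) (T_normal : A_normal A T) :
  closure (numerical_range_A A T) `<=` convex_hull (spectrum_A A T).
Proof.
move=> z Wz; apply: contrapT => nCz.
have [bT _] := T_BA; have linT := bT.1; pose T' := pack_linear linT.
have [linA _] := A_pos.1; pose A' := pack_linear linA.
have [a a0 aC] := weak_separation (@convex_convex_hull _ _) nCz.
have [U [adjU normU]] := A_normal_adjoint A_pos bT T_normal.
have [c c0 Tc] := A_normal_bounded A_pos bT adjU normU.
have hA := semi_inner_A A_pos.
set g := re_inner_A A in adjU normU Tc hA.
pose N : {linear H -> H} := (a \*: (T' \+ (- z) \*: idfun)).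
pose N' : {linear H -> H} := (a^*%C \*: (U \+ (- z^*%C) \*: idfun)).
have NE x : N x = a *: (T x - z *: x) by rewrite -scaleNr.
have N'E x : N' x = a^*%C *: (U x - z^*%C *: x) by rewrite -scaleNr.
clearbody N N'.
have adj x y : g (N x) y = g x (N' y).
  rewrite NE N'E si_conj// siBl// adjU si_conj// linearZ -siBr//.
  by rewrite scalerBr !scalerA [a^*%C * _]mulrC.
have adj' x y : g (N' x) y = g x (N y) by rewrite (siC hA) -adj (siC hA).
have nrm x : g (N x) (N x) = g (N' x) (N' x).
  rewrite NE N'E !sqZc// (@sq_normal_shift _ _ _ hA T' U z x adjU normU).
  by case: (a) => a1 a2 /=; rewrite sqrrN.
pose a2 := complex.Re a ^+ 2 + complex.Im a ^+ 2.
have a2_gt0 : 0 < a2 by rewrite -ltcR add_Re2_Im2 exprn_gt0// normr_gt0.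
pose z2 := complex.Re z ^+ 2 + complex.Im z ^+ 2.
have NL x : g (N x) (N x) <= a2 * (2 * (c + z2)) * g x x.
  rewrite NE sqZc// -/a2 -mulrA ler_pM2l//.
  rewrite (le_trans (sqD_le hA _ _))// siNl// siNr// opprK sqZc// -/z2.
  by have := Tc x; lra.
have approx h : 0 < h -> exists x, [/\ 0 < g x x, `|g (N x) x| <= h * g x x &
    `|g (N x) ('i%C *: x)| <= h * g x x].
  move=> h0; have [s s0 as_h] : exists2 s : R, 0 < s & `|a| * s%:C%C <= h%:C%C.
    have aE : (complex.Re `|a|)%:C%C = `|a| by rewrite RRe_real.
    have na : 0 < complex.Re `|a| by rewrite -ltcR aE normr_gt0.
    exists (h / complex.Re `|a|); first by rewrite divr_gt0.
    by rewrite -aE -rmorphM mulrC divfK ?gt_eqF.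
  have [_ [x x1 ->] zw] := closure_approx Wz s0.
  have xx := norm_A_eq1 x1.
  have gx : g x x = 1 by have := xx; rewrite inner_A_re => -[].
  have Nx : inner_A A (N x) x = a * (inner_A A (T x) x - z).
    rewrite NE /inner_A -[A _]/(A' _) linearZ linearB linearZ /=.
    rewrite linearZl_LR linearBl linearZl_LR /= -/(inner_A A x x) xx.
    by rewrite mulr1.
  have Nh : `|inner_A A (N x) x| <= h%:C%C.
    by rewrite Nx normrM distrC (le_trans _ as_h)// ler_wpM2l// ltW.
  move: Nh; rewrite inner_A_re -/(g _ _) -/(g _ _) => Nh.
  exists x; rewrite gx ltr01 mulr1 -!lecR; split => //.
    exact: le_trans (normc_ge_Re _) Nh.
  rewrite -[g (N x) ('i%C *: x)]/(complex.Im (g (N x) x +i* g (N x) ('i%C *: x))%C).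
  rewrite -normrN -ReiNIm (le_trans (normc_ge_Re _))// normrM.
  by rewrite [`|'i%C|]normc_def /= expr0n expr1n add0r sqrtr1 mulr1.
(* An approximate eigenvalue [l] of [N = a (T - z)] corresponds to [z + l / a] for [T]. *)
have spec (l : R[i]) : (forall e : R, 0 < e -> exists2 v, 0 < g v v &
    let d := N v - l *: v in g d d <= e * g v v) -> spectrum_A A T (z + l / a).
  move=> hl; apply: (approx_eigenvalue_spectrum A_pos) => e e0.
  have [|v v0 /= hv] := hl (a2 * e); first by rewrite mulr_gt0.
  exists v => //=; move: hv.
  have -> : N v - l *: v = a *: (T v - (z + l / a) *: v).
    by rewrite NE scalerDl opprD addrA [in RHS]scalerBr scalerA mulrC divfK.
  by rewrite sqZc// -/a2 -mulrA ler_pM2l.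
(* The imaginary part of [N'] is opposite to that of [N], so exchanging the two operators supplies
   the second spectral point. *)
have approx' h : 0 < h -> exists x, [/\ 0 < g x x, `|g (N' x) x| <= h * g x x &
    `|g (N' x) ('i%C *: x)| <= h * g x x].
  move=> /approx[x [x0 h1 h2]]; exists x; split => //.
    by rewrite adj' (siC hA).
  by rewrite adj' linearZ (siC hA) si_im// normrN.
have N'L x : g (N' x) (N' x) <= a2 * (2 * (c + z2)) * g x x by rewrite -nrm.
have nrm' x : g (N' x) (N' x) = g (N x) (N x) by rewrite nrm.
have [M [mu [M0 Mmu /spec sp]]] := normal_approx_eigenvalue hA adj nrm NL approx.
have [M' [mu' [M'0 M'mu' hM']]] := normal_approx_eigenvalue hA adj' nrm' N'L approx'.
(* Normality turns an approximate eigenvalue of [N'] into its conjugate for [N]. *)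
have sp' : spectrum_A A T (z + (M' -i* mu')%C / a).
  apply: spec => e /hM'[v v0 /= hv]; exists v => //=.
  by rewrite (sq_normal_shift hA _ _ adj nrm) /= opprK.
have hull := @sub_gen_smallest _ (@convex_set R[i] R[i]^o) (spectrum_A A T).
have shift (l : R[i]) : a * (z + l / a - z) = l by rewrite addrC addKr mulrC divfK.
have ME : M = 0.
  by apply/eqP; rewrite eq_le M0 andbT; have := aC _ (hull _ sp); rewrite shift.
have M'E : M' = 0.
  by apply/eqP; rewrite eq_le M'0 andbT; have := aC _ (hull _ sp'); rewrite shift.
have mu0 := Mmu ME; have mu'0 := M'mu' M'E.
apply: nCz; have [s0|s0] := eqVneq (mu + mu') 0.
  have mu_eq0 : mu = 0 by lra.
  have := hull _ sp; rewrite ME mu_eq0.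
  by have -> : (0 +i* 0)%C = 0 :> R[i] by []; rewrite mul0r addr0.
have s_gt0 : 0 < mu + mu' by rewrite lt_neqAle eq_sym s0 addr_ge0.
(* This weight averages [i mu] and [- i mu'] to 0, so the convex combination is [z]. *)
have t01 : 0 <= mu' / (mu + mu') <= 1.
  by rewrite divr_ge0 ?addr_ge0//= ler_pdivrMr// mul1r lerDr.
have := convex_setP (@convex_convex_hull _ _) (hull _ sp) (hull _ sp') t01.
congr (convex_hull _ _); rewrite ME M'E !mulrDr addrACA -mulrDl -rmorphD/=.
rewrite (_ : mu' / (mu + mu') + (1 - mu' / (mu + mu')) = 1) ?mul1r; last by ring.
rewrite !mulrA -mulrDl.
rewrite (_ : _ + _ * (0 -i* mu')%C = 0) ?mul0r ?addr0//.
by apply/eqP; rewrite eq_complex /=; apply/andP; split; apply/eqP; field.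
Qed.
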